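(* Let $m,k\ge1$ be integers and let $P_m,\dots,P_{m+k-1}\in\mathbb{Z}[y]$ be polynomials such that the linear combination $a_mP_m+\dots+a_{m+k-1}P_{m+k-1}$ has degree at least $m$ unless $a_m=\dots=a_{m+k-1}=0$ (in particular, $P_m,\dots,P_{m+k-1}$ are linearly independent and each of them has degree at least $m$). Suppose that $p$ is a prime and $f_0,\dots,f_{m+k-1}:\mathbb{F}_p\to\mathbb{C}$ satisfy $|f_j(x)|\le 1$ for each $0\le j\le m+k-1$ and $x\in\mathbb{F}_p$. Then $$\mathbb{E}_{x,y\in\mathbb{F}_p}\prod_{j=0}^{m-1}f_j(x+jy)\prod_{j=m}^{m+k-1}f_j(x+P_j(y)) =\left(\mathbb{E}_{x,y\in\mathbb{F}_p}\prod_{j=0}^{m-1}f_j(x+jy)\right)\prod_{j=m}^{m+k-1}\mathbb{E}f_j+O(p^{-c}),$$ where all the constants ($c$ and the implied constant) are positive and depend on $m$, $k$ and $P_m,\dots,P_{m+k-1}$ but not on $f_0,\dots,f_{m+k-1}$.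
   Context: $\mathbb{E}_{x\in X}f(x)=\frac1{|X|}\sum_{x\in X}f(x)$, and $\mathbb{E}f=\mathbb{E}_{x\in\mathbb{F}_p}f(x)$ for $f:\mathbb{F}_p\to\mathbb{C}$. The notation $O(p^{-c})$ denotes a quantity bounded in absolute value by $Cp^{-c}$ for all sufficiently large primes $p$, where $C$ and the threshold on $p$ do not depend on the functions $f_j$. Linear combinations of the $P_j$ are taken with real (equivalently integer) coefficients $a_j$. *)

(* Defs.v *)
From HB Require Import structures.
From mathcomp Require Import all_boot all_order all_algebra.
From mathcomp Require Import reals exp.
From mathcomp.real_closed Require Import complex.

Set Implicit Arguments.
Unset Strict Implicit.
Unset Printing Implicit Defensive.

Import Order.TTheory GRing.Theory Num.Theory.

Local Open Scope ring_scope.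
Local Open Scope complex_scope.

Definition avg (R : rcfType) (T : finType) (F : T -> R[i]) : R[i] :=
  (#|T|%:R)^-1 * \sum_(x : T) F x.

(* Value in the ring A of an integer polynomial; for A := 'F_p this is
   reduction mod p followed by evaluation. *)
Definition zeval (A : comNzRingType) (P : {poly int}) (y : A) : A :=
  (map_poly intr P).[y].

(* The family is P_m, ..., P_(m+k-1), indexed by the naturals j with
   m <= j < m + k; the values of P and a at other indices are irrelevant.
   Since size = degree + 1 and size 0 = 0, [m < size q] says that q is nonzero
   of degree at least m. *)
Definition lincomb_deg_ge (R : realType) (m k : nat) (P : nat -> {poly int}) :
    Prop :=
  forall a : nat -> R,
    (exists2 j : nat, (m <= j < m + k)%N & a j != 0) ->
    (m < size (\sum_(m <= j < m + k) a j *: map_poly intr (P j))%R)%N.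

(* Main.v *)
Require Import Defs.
From HB Require Import structures.
From mathcomp Require Import all_boot all_order all_algebra.
From mathcomp Require Import reals exp.
From mathcomp.real_closed Require Import complex.

Set Implicit Arguments.
Unset Strict Implicit.
Unset Printing Implicit Defensive.

Import Order.TTheory GRing.Theory Num.Theory.

Local Open Scope ring_scope.

(** Why the theorem is true. Everything is done over a finite field F of large
    characteristic, with an additive character e, for counts with a phase: the
    average over x and y of the product of the f_j(x + j y), of the
    f_j(x + P_j(y)) and of e(Q(y)). All the bounds have the form
    |count|^(2^n) <= K/|F|, with n and K independent of F and of the functions.
    Writing a function as its mean plus a function of mean zero, and doing this
    first for a polynomial P_r of maximal degree, it is enough to bound the count
    when its function f_r has mean zero ([mean_zero_small]).

    Let D be the dual function, so that the count is E f_r D. As f_r has mean zero,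
    D may be replaced by its centred version D' = (D - E D)/2, and by
    Cauchy-Schwarz the square of the count is at most twice the absolute value of
    the count with f_r replaced by the conjugate of D' ([counting_le_dual]). PET
    induction ([pet]), that is, repeated van der Corput differencing, bounds this
    count by a Gowers norm of D' of some order s + 1, where s depends only on the
    degrees and the number of terms. PET needs a head function whose polynomial
    is of maximal degree and differs from the others by non-constants.

    Degree lowering ([degree_lowering]) then reduces the order of the norm one by
    one. If the norm of order s + 2 of D' is large, then for many t in F^s the
    derivative of D' along t correlates with a character, of frequency phi(t) say.
    In this derivative only the factor D'(x + t_1 + ... + t_s) depends on all the
    coordinates of t. Written as an average over y, it survives the
    Cauchy-Schwarz inequalities that remove the other factors
    ([box_cauchy_schwarz]). What is left is an average, over pairs t, u, of
    correlations of derivatives of the kernel of D' with the character whose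
    frequency is the alternating sum psi(t,u) of the values of phi at the vertices
    of the box spanned by t and u. Such a correlation is a count with one
    polynomial term less, the phase now being a nontrivial combination that
    involves P_r ([counting_twist]); by induction it is small unless psi(t,u) = 0.
    So psi vanishes for many pairs. For u fixed, phi(t) is then a sum of functions
    each of which misses a coordinate of t, and a further use of the box
    inequality removes it and bounds the average by the norm of order s + 1
    ([low_freq_gowers]). At the end only the mean of D' is left, which is zero.
    It is there that centring is needed: the mean of D itself is just the count
    without f_r, and it need not be small.

    The induction starts with no polynomial terms, a nontrivial phase and the m
    linear terms ([weyl]). Each differencing step removes one of the m functions
    and lowers the degree of the phase by one. This is where the hypothesis
    enters: the phase is a nontrivial combination of the P_j, so its degree is at
    least m, and it is not yet constant when only one function is left. Further
    steps then make it linear, and its sum vanishes. The hypothesis passes to all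
    large primes because it says that an integer matrix has full rank
    ([indep_mod_p]). *)

(** * Averages over finite types *)

(** Locked, as unification would otherwise see every average as a product. *)
HB.lock Definition mean (C : numClosedFieldType) (T : finType) (F : T -> C) : C :=
  (#|T|%:R)^-1 * \sum_(x : T) F x.

Notation "\mean_ ( x : T ) F" := (mean (fun x : T => F))
  (at level 41, x at level 99, F at level 41).

Section Mean.
Variable C : numClosedFieldType.
Implicit Types T U : finType.

Lemma meanE T (F : T -> C) : mean F = (#|T|%:R)^-1 * \sum_(x : T) F x.
Proof. by rewrite unlock. Qed.

Lemma eq_mean T (F G : T -> C) : F =1 G -> mean F = mean G.
Proof. by move=> FG; rewrite !meanE; congr (_ * _); apply: eq_bigr => x _; rewrite FG. Qed.

Lemma meanD T (F G : T -> C) :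
  \mean_(x : T) (F x + G x) = mean F + mean G.
Proof. by rewrite !meanE big_split mulrDr. Qed.

Lemma mean_mull T c (F : T -> C) : \mean_(x : T) (c * F x) = c * mean F.
Proof. by rewrite unlock -mulr_sumr mulrCA. Qed.

Lemma mean_mulr T c (F : T -> C) : \mean_(x : T) (F x * c) = mean F * c.
Proof. by rewrite !meanE -mulr_suml mulrA. Qed.

Lemma meanN T (F : T -> C) : \mean_(x : T) - F x = - mean F.
Proof. by rewrite !meanE sumrN mulrN. Qed.

Lemma meanB T (F G : T -> C) :
  \mean_(x : T) (F x - G x) = mean F - mean G.
Proof. by rewrite meanD meanN. Qed.

Lemma mean_conj T (F : T -> C) : \mean_(x : T) (F x)^* = (mean F)^*.
Proof. by rewrite !meanE rmorphM /= fmorphV rmorph_nat rmorph_sum. Qed.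

Lemma mean_sum T (I : Type) (r : seq I) (F : I -> T -> C) :
  \mean_(x : T) (\sum_(i <- r) F i x) = \sum_(i <- r) mean (F i).
Proof. by rewrite unlock exchange_big /= mulr_sumr. Qed.

Lemma mean_exchange T U (F : T -> U -> C) :
  \mean_(x : T) (\mean_(y : U) F x y) = \mean_(y : U) (\mean_(x : T) F x y).
Proof.
rewrite unlock -!mulr_sumr exchange_big /= mulrCA; congr (_ * (_ * _)).
Qed.

Lemma mean_pair T U (F : T * U -> C) :
  mean F = \mean_(x : T) (\mean_(y : U) F (x, y)).
Proof.
rewrite unlock -mulr_sumr mulrA card_prod natrM invfM; congr (_ * _).
by rewrite pair_bigA; apply: eq_bigr => -[].
Qed.

Lemma mean_ge0 T (F : T -> C) : (forall x, 0 <= F x) -> 0 <= mean F.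
Proof. by move=> F0; rewrite meanE mulr_ge0 ?invr_ge0 ?ler0n ?sumr_ge0. Qed.

Lemma ler_mean T (F G : T -> C) : (forall x, F x <= G x) -> mean F <= mean G.
Proof.
by move=> FG; rewrite !meanE ler_wpM2l ?invr_ge0 ?ler0n //; apply: ler_sum.
Qed.

Lemma ler_norm_mean T (F : T -> C) : `|mean F| <= \mean_(x : T) `|F x|.
Proof.
rewrite !meanE normrM ger0_norm ?invr_ge0 ?ler0n //.
by rewrite ler_wpM2l ?invr_ge0 ?ler0n // ler_norm_sum.
Qed.

Lemma mean_const T (c : C) : (0 < #|T|)%N -> \mean_(x : T) c = c.
Proof.
have sumE : \sum_(x : T) c = #|T|%:R * c by rewrite sumr_const mulr_natl.
move=> T0; rewrite !meanE sumE mulKf //.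
by rewrite pnatr_eq0 -lt0n.
Qed.

Lemma mean0 T : \mean_(x : T) (0 : C) = 0.
Proof. by rewrite !meanE big1 ?mulr0. Qed.

Lemma mean_le_const T (c : C) (F : T -> C) :
  0 <= c -> (forall x, F x <= c) -> mean F <= c.
Proof.
move=> c0 Fc; have [T0|T0] := posnP #|T|.
  by rewrite !meanE T0 invr0 mul0r.
by rewrite -[leRHS](mean_const c T0); apply: ler_mean.
Qed.

Lemma norm_mean_le1 T (F : T -> C) : (forall x, `|F x| <= 1) -> `|mean F| <= 1.
Proof.
by move=> F1; apply: (le_trans (ler_norm_mean F)); apply: mean_le_const.
Qed.

Lemma mean_reindex T (h : T -> T) (F : T -> C) :
  injective h -> mean F = \mean_(x : T) F (h x).
Proof. by move=> hI; rewrite !meanE (reindex_inj hI). Qed.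

Lemma mean_single T x0 (F : T -> C) : (forall x, x = x0) -> mean F = F x0.
Proof.
move=> Tx; have eqT : pred1 x0 =i T by move=> x; rewrite (Tx x) !inE eqxx.
rewrite !meanE -(eq_card eqT) card1 invr1 mul1r (big_pred1 x0) // => x.
by rewrite (Tx x) /= eqxx.
Qed.

(** The variance is nonnegative. Every Cauchy-Schwarz step below has this
    shape: the factor removed by it is bounded by 1, so that only the square of
    an average has to be compared with the average of the squares. *)
Lemma norm_mean_sqr T (F : T -> C) : `|mean F| ^+ 2 <= \mean_(x : T) `|F x| ^+ 2.
Proof.
have [T0|T0] := posnP #|T|.
  by rewrite !meanE T0 invr0 !mul0r normr0 expr0n.
set a := mean F; rewrite -subr_ge0.
have -> : \mean_(x : T) `|F x| ^+ 2 - `|a| ^+ 2 = \mean_(x : T) `|F x - a| ^+ 2.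
  under [RHS]eq_mean => x do
    rewrite normCK rmorphB mulrBl !mulrBr -!normCK.
  rewrite !meanB mean_mulr mean_mull mean_conj mean_const // -/a.
  by rewrite -normCK subrr subr0.
by apply: mean_ge0 => x; rewrite exprn_ge0.
Qed.

Lemma mean_mul_sqr T (F G : T -> C) : (forall x, `|F x| <= 1) ->
  `|\mean_(x : T) (F x * G x)| ^+ 2 <= \mean_(x : T) `|G x| ^+ 2.
Proof.
move=> F1; apply: (le_trans (norm_mean_sqr _)); apply: ler_mean => x.
rewrite normrM exprMn ler_piMl ?exprn_ge0 // exprn_ile1 //.
Qed.

Lemma mean_exp2 T (F : T -> C) n : (forall x, 0 <= F x) ->
  mean F ^+ (2 ^ n) <= \mean_(x : T) F x ^+ (2 ^ n).
Proof.
move=> F0; elim: n => [|n IH]; first by rewrite expr1.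
have m0 := mean_ge0 F0.
have G0 x : 0 <= F x ^+ (2 ^ n) by rewrite exprn_ge0.
rewrite expnS mulnC exprM.
apply: (@le_trans _ _ ((\mean_(x : T) F x ^+ (2 ^ n)) ^+ 2)).
  by rewrite lerXn2r ?nnegrE ?exprn_ge0 ?mean_ge0.
have := norm_mean_sqr (fun x => F x ^+ (2 ^ n)).
rewrite (ger0_norm (mean_ge0 G0)) => h; apply: (le_trans h).
by apply: ler_mean => x; rewrite (ger0_norm (G0 x)) exprM.
Qed.

Lemma addr_exp2 (a b : C) n : 0 <= a -> 0 <= b ->
  (a + b) ^+ (2 ^ n) <= 2 ^+ (2 ^ n) * (a ^+ (2 ^ n) + b ^+ (2 ^ n)).
Proof.
move=> a0 b0; have h := @mean_exp2 bool (fun x => if x then a else b) n.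
have : forall x : bool, 0 <= (if x then a else b) by case.
move/h; rewrite !meanE !big_bool /= card_bool exprMn exprVn.
rewrite ler_pdivrMl ?exprn_gt0 ?ltr0n // => {}h.
apply: (le_trans h); rewrite ler_wpM2l ?exprn_ge0 ?ler0n //.
rewrite ler_piMl ?addr_ge0 ?exprn_ge0 // invf_le1 ?ltr0n // ler1n //.
Qed.

Lemma mean_tuple0 (V : finType) (F : seq V -> C) : \mean_(t : 0.-tuple V) F t = F [::].
Proof. by rewrite (@mean_single _ [tuple]) // => t; apply: tuple0. Qed.

Lemma mean_tupleS (V : finType) s (F : seq V -> C) :
  \mean_(t : s.+1.-tuple V) F t =
  \mean_(h : V) (\mean_(t : s.-tuple V) F (h :: t)).
Proof.
rewrite unlock -mulr_sumr mulrA !card_tuple expnS natrM invfM; congr (_ * _).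
rewrite pair_bigA /=.
rewrite (reindex (fun u : V * s.-tuple V => [tuple of u.1 :: u.2])) /=.
  by apply: eq_bigr => -[].
exists (fun t => (thead t, [tuple of behead t])) => [[h t]|t] _ /=.
  by rewrite theadE; congr pair; apply: val_inj.
by rewrite -tuple_eta.
Qed.

End Mean.

Section Shift.
Variables (C : numClosedFieldType) (V : finZmodType).

Lemma mean_shift (h : V) (F : V -> C) : mean F = \mean_(x : V) F (x + h).
Proof. by apply: mean_reindex; apply: addIr. Qed.

Lemma mean_shiftl (h : V) (F : V -> C) : mean F = \mean_(x : V) F (h + x).
Proof. by apply: mean_reindex; apply: addrI. Qed.

(** Van der Corput's differencing: the square of an average in y is an average
    of correlations in which y only occurs through differences. This is what
    lowers the degrees of the polynomials in y. *)
Lemma norm_mean_corr (F : V -> C) :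
  `|mean F| ^+ 2 = \mean_(h : V) (\mean_(y : V) (F (y + h) * (F y)^*)).
Proof.
rewrite normCK -mean_conj -mean_mull mean_exchange; apply: eq_mean => y.
by rewrite mean_mulr -mean_shiftl.
Qed.

Lemma vdc (T : finType) (F : T -> V -> C) :
  \mean_(x : T) `|\mean_(y : V) F x y| ^+ 2 =
  \mean_(h : V) (\mean_(x : T) (\mean_(y : V) (F x (y + h) * (F x y)^*))).
Proof.
by under eq_mean => x do rewrite norm_mean_corr; rewrite mean_exchange.
Qed.

End Shift.

(** * Bounds up to a power *)

Section Domination.
Variable C : numClosedFieldType.
Implicit Types a b c eps : C.

(** Up to the error [eps], [a] is bounded by a positive power of [b]. Exponents
    are powers of 2 since each application of Cauchy-Schwarz squares. *)
Definition dom eps n (K : nat) a b := a ^+ (2 ^ n) <= K%:R * (b + eps).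

Lemma dom_trans eps n m K L a b c :
  0 <= eps -> eps <= 1 -> 0 <= a -> 0 <= b -> 0 <= c ->
  dom eps n K a b -> dom eps m L b c ->
  dom eps (n + m) ((2 * K) ^ (2 ^ m) * L.+1) a c.
Proof.
move=> e0 e1 a0 b0 c0 ab bc; rewrite /dom expnD exprM.
set M := (2 ^ m)%N in bc *.
have be0 : 0 <= b + eps by rewrite addr_ge0.
apply: (@le_trans _ _ ((K%:R * (b + eps)) ^+ M)).
  by rewrite lerXn2r ?nnegrE ?exprn_ge0 // mulr_ge0 ?ler0n.
rewrite exprMn expnMn !natrM !natrX [2 ^+ M * _]mulrC -!mulrA.
rewrite ler_wpM2l ?exprn_ge0 ?ler0n //.
apply: (le_trans (addr_exp2 m b0 e0)); rewrite ler_wpM2l ?exprn_ge0 ?ler0n //.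
rewrite -natr1 mulrDl mul1r lerD // (@le_trans _ _ eps) ?lerDr //.
by rewrite ler_iXnr // expn_gt0.
Qed.

Lemma dom_le eps n n' (K K' : nat) a b : 0 <= eps -> 0 <= a -> a <= 1 -> 0 <= b ->
  (n <= n')%N -> (K <= K')%N -> dom eps n K a b -> dom eps n' K' a b.
Proof.
move=> e0 a0 a1 b0 nn' KK' ab; rewrite /dom.
apply: (@le_trans _ _ (a ^+ (2 ^ n))); first by rewrite ler_wiXn2l // leq_pexp2l.
by apply: (le_trans ab); rewrite ler_wpM2r ?addr_ge0 // ler_nat.
Qed.

End Domination.

(** * Multiplicative derivatives and Gowers norms *)

Section Differences.
Variables (C : numClosedFieldType) (V : finZmodType).
Implicit Types (f g : V -> C) (t : seq V) (h x : V).

Definition mder h f : V -> C := fun x => f (x + h) * (f x)^*.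

Definition mders t f : V -> C := foldr mder f t.

(** The 2^(s+1)-th power of the Gowers norm of order s+1, in a form in which it
    is visibly a nonnegative real. *)
Definition gowers s f : C := \mean_(t : s.-tuple V) `|mean (mders t f)| ^+ 2.

Lemma eq_mders t f g : f =1 g -> mders t f =1 mders t g.
Proof.
by elim: t => //= h t IH fg x; rewrite /mder !IH.
Qed.

Lemma mder_bound h f :
  (forall x, `|f x| <= 1) -> forall x, `|mder h f x| <= 1.
Proof. by move=> f1 x; rewrite normrM norm_conjC mulr_ile1. Qed.

Lemma mders_bound t f :
  (forall x, `|f x| <= 1) -> forall x, `|mders t f x| <= 1.
Proof. by move=> f1; elim: t => //= h t; apply: mder_bound. Qed.

Lemma mdersM t f g x :
  mders t (fun x => f x * g x) x = mders t f x * mders t g x.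
Proof. by elim: t x => //= h t IH x; rewrite /mder !IH rmorphM mulrACA. Qed.

Lemma mders_shift t c f x :
  mders t (fun x => f (x + c)) x = mders t f (x + c).
Proof. by elim: t x => //= h t IH x; rewrite /mder !IH addrAC. Qed.

Lemma mders_conj t f x : mders t (fun x => (f x)^*) x = (mders t f x)^*.
Proof. by elim: t x => //= h t IH x; rewrite /mder !IH rmorphM. Qed.

Lemma mder_comm h k f x : mder h (mder k f) x = mder k (mder h f) x.
Proof.
by rewrite /mder !rmorphM /= !conjCK (addrAC x) mulrACA.
Qed.

Lemma mders_mder t h f : mders t (mder h f) =1 mders (h :: t) f.
Proof.
elim: t => //= k t IH x.
by rewrite -[RHS]mder_comm /mder !IH.
Qed.

Lemma mean_mder_sqr f :
  \mean_(h : V) mean (mder h f) = `|mean f| ^+ 2.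
Proof. by rewrite norm_mean_corr. Qed.

Lemma gowers_ge0 s f : 0 <= gowers s f.
Proof. by apply: mean_ge0 => t; rewrite exprn_ge0. Qed.

Lemma gowers0 f : gowers 0 f = `|mean f| ^+ 2.
Proof. by rewrite /gowers (mean_tuple0 (fun t => `|mean (mders t f)| ^+ 2)). Qed.

Lemma gowersS s f : gowers s.+1 f = \mean_(h : V) gowers s (mder h f).
Proof.
rewrite /gowers (mean_tupleS s (fun t => `|mean (mders t f)| ^+ 2)).
apply: eq_mean => h; apply: eq_mean => t; congr (`|_| ^+ 2).
by apply: eq_mean => x; rewrite mders_mder.
Qed.

Lemma gowers_conj s f : gowers s (fun x => (f x)^*) = gowers s f.
Proof.
apply: eq_mean => t; congr (_ ^+ 2); rewrite -[RHS]norm_conjC -mean_conj.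
by congr (`|_|); apply: eq_mean => x; rewrite mders_conj.
Qed.

Lemma gowersE s f :
  gowers s f = \mean_(t : s.-tuple V) (\mean_(h : V) mean (mder h (mders t f))).
Proof. by apply: eq_mean => t; rewrite mean_mder_sqr. Qed.

Lemma gowers_le1 s f : (forall x, `|f x| <= 1) -> gowers s f <= 1.
Proof.
move=> f1; apply: mean_le_const => // t.
by rewrite exprn_ile1 // norm_mean_le1 //; apply: mders_bound.
Qed.

Lemma gowers_sqr s f : gowers s f ^+ 2 <= gowers s.+1 f.
Proof.
rewrite gowersE -[X in X ^+ 2]ger0_norm; last first.
  by rewrite -gowersE gowers_ge0.
apply: (le_trans (norm_mean_sqr _)).
rewrite gowersS /gowers mean_exchange; apply: ler_mean => t.
apply: (le_trans (norm_mean_sqr _)); apply: ler_mean => h.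
rewrite le_eqVlt; apply/orP; left; apply/eqP; congr (`|_| ^+ 2).
by apply: eq_mean => x; rewrite mders_mder.
Qed.

Lemma gowers_exp2 s n f : gowers s f ^+ (2 ^ n) <= gowers (s + n) f.
Proof.
elim: n => [|n IH]; first by rewrite addn0 expr1.
rewrite addnS expnS mulnC exprM; apply: le_trans (gowers_sqr _ _).
by rewrite lerXn2r ?nnegrE ?exprn_ge0 // gowers_ge0.
Qed.

End Differences.

(** * The box Cauchy-Schwarz inequality *)

Section BoxCauchySchwarz.
Variables (C : numClosedFieldType) (V : finZmodType).
Implicit Types (phi : seq V -> C) (t u : seq V).

(** Cauchy-Schwarz in the i-th coordinate produces two values [t_i], [u_i] of it.
    After all the coordinates there are 2^s copies of [phi], one for each vertex
    of the box with these sides; those with an odd number of [u_i] are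
    conjugated. *)
Fixpoint cube t u phi : C :=
  match t, u with
  | h :: t', k :: u' => cube t' u' (fun v => phi (h :: v) * (phi (k :: v))^*)
  | _, _ => phi [::]
  end.

(** The functions that [box_cauchy_schwarz] removes: products of s functions
    bounded by 1, the i-th of which does not depend on the i-th coordinate. The
    factors for all parameters z are provided at once, so that no choice is
    needed when z is averaged. *)
Fixpoint low (Z : Type) s (b : Z -> seq V -> C) : Prop :=
  match s with
  | 0 => forall z, b z [::] = 1
  | s'.+1 => exists (b1 : Z -> seq V -> C) (b2 : V -> Z -> seq V -> C),
      [/\ forall z h t, b z (h :: t) = b1 z t * b2 h z t,
          forall z t, `|b1 z t| <= 1
        & forall h, low s' (b2 h)]
  end.

Lemma lowM (Z : Type) s (b b' : Z -> seq V -> C) :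
  low s b -> low s b' -> low s (fun z t => b z t * b' z t).
Proof.
elim: s b b' => [|s IH] b b' /=; first by move=> b0 b0' z; rewrite b0 b0' mulr1.
move=> [b1 [b2 [bE b1_1 b2l]]] [c1 [c2 [cE c1_1 c2l]]].
exists (fun z t => b1 z t * c1 z t), (fun h z t => b2 h z t * c2 h z t).
split=> [z h t|z t|h]; first by rewrite bE cE mulrACA.
  by rewrite normrM mulr_ile1.
exact: IH.
Qed.

Lemma low_conj (Z : Type) s (b : Z -> seq V -> C) :
  low s b -> low s (fun z t => (b z t)^*).
Proof.
elim: s b => [|s IH] b /=; first by move=> b0 z; rewrite b0 rmorph1.
move=> [b1 [b2 [bE b1_1 b2l]]].
exists (fun z t => (b1 z t)^*), (fun h z t => (b2 h z t)^*).
split=> [z h t|z t|h]; first by rewrite bE rmorphM.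
  by rewrite norm_conjC.
exact: IH.
Qed.

(** One application of Cauchy-Schwarz per coordinate removes the factor of the
    low function that is independent of this coordinate and doubles the
    coordinate. The parameter z stays averaged inside the absolute value. *)
Lemma box_cauchy_schwarz (Z : finType) s (f b : Z -> seq V -> C) : low s b ->
  `|\mean_(z : Z) (\mean_(t : s.-tuple V) (f z t * b z t))| ^+ (2 ^ s) <=
  \mean_(t : s.-tuple V) (\mean_(u : s.-tuple V)
     `|\mean_(z : Z) cube t u (f z)|).
Proof.
elim: s f b => [|s IH] f b.
  move=> /= b0; rewrite expr1.
  rewrite (mean_tuple0 (fun t => \mean_(u : 0.-tuple V)
    `|\mean_(z : Z) cube t u (f z)|)).
  rewrite (mean_tuple0 (fun u => `|\mean_(z : Z) cube [::] u (f z)|)) /=.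
  rewrite le_eqVlt; apply/orP; left; apply/eqP; congr (`|_|).
  apply: eq_mean => z.
  by rewrite (mean_tuple0 (fun t => f z t * b z t)) b0 mulr1.
move=> /= [b1 [b2 [bE b1_1 b2l]]].
pose G (z : Z) t h := f z (h :: t) * b2 h z t.
have -> : \mean_(z : Z) (\mean_(t : s.+1.-tuple V) (f z t * b z t)) =
    \mean_(zt : Z * s.-tuple V)
      (b1 zt.1 zt.2 * \mean_(h : V) G zt.1 zt.2 h).
  rewrite [RHS]mean_pair; apply: eq_mean => z /=.
  rewrite (mean_tupleS s (fun t => f z t * b z t)) mean_exchange.
  apply: eq_mean => t; rewrite -mean_mull; apply: eq_mean => h.
  by rewrite bE mulrCA.
pose f' (hk : V * V) z t := f z (hk.1 :: t) * (f z (hk.2 :: t))^*.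
pose b' (hk : V * V) z t := b2 hk.1 z t * (b2 hk.2 z t)^*.
pose H hk := \mean_(z : Z) (\mean_(t : s.-tuple V) (f' hk z t * b' hk z t)).
have -> : \mean_(t : s.+1.-tuple V) (\mean_(u : s.+1.-tuple V)
     `|\mean_(z : Z) cube t u (f z)|) =
   \mean_(hk : V * V) (\mean_(t : s.-tuple V) (\mean_(u : s.-tuple V)
     `|\mean_(z : Z) cube t u (f' hk z)|)).
  rewrite (mean_tupleS s (fun t => \mean_(u : s.+1.-tuple V)
     `|\mean_(z : Z) cube t u (f z)|)) mean_pair; apply: eq_mean => h.
  under eq_mean => t do rewrite (mean_tupleS s (fun u =>
     `|\mean_(z : Z) cube (h :: t) u (f z)|)).
  by rewrite mean_exchange.
rewrite expnS exprM.
apply: (@le_trans _ _ ((\mean_(hk : V * V) `|H hk|) ^+ (2 ^ s))).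
  rewrite lerXn2r ?nnegrE ?exprn_ge0 //; first by apply: mean_ge0.
  apply: (le_trans (mean_mul_sqr _ _)) => [[z t]|]; first exact: b1_1.
  rewrite -[leLHS]ger0_norm; last first.
    by apply: mean_ge0 => zt; rewrite exprn_ge0.
  have -> : \mean_(zt : Z * s.-tuple V) `|\mean_(h : V) G zt.1 zt.2 h| ^+ 2 =
      \mean_(hk : V * V) H hk.
    under eq_mean => zt do rewrite normCK -mean_conj -mean_mulr.
    under eq_mean => zt do under eq_mean => h do rewrite -mean_mull.
    rewrite mean_exchange mean_pair; apply: eq_mean => h.
    rewrite mean_exchange; apply: eq_mean => k; rewrite mean_pair.
    apply: eq_mean => z; apply: eq_mean => t /=.
    by rewrite /G /f' /b' /= rmorphM mulrACA.
  exact: ler_norm_mean.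
apply: (le_trans (mean_exp2 s _)) => //.
apply: ler_mean => -[h k]; apply: IH.
by apply: lowM (b2l _) _; apply: low_conj.
Qed.

Lemma eq_cube t u phi psi : phi =1 psi -> cube t u phi = cube t u psi.
Proof.
elim: t u phi psi => [|h t IH] [|k u] phi psi pq //=.
by apply: IH => v; rewrite !pq.
Qed.

Lemma cubeM t u phi psi : cube t u (fun v => phi v * psi v) =
  cube t u phi * cube t u psi.
Proof.
elim: t u phi psi => [|h t IH] [|k u] phi psi //=.
by rewrite -IH; apply: eq_cube => v; rewrite rmorphM mulrACA.
Qed.

Lemma norm_cube t u phi : size t = size u -> (forall v, `|phi v| <= 1) ->
  `|cube t u phi| <= `|phi t|.
Proof.
elim: t u phi => [|h t IH] [|k u] phi //= [tu] phi1.
apply: (le_trans (IH _ _ tu _)) => [v|]; first by rewrite normrM mulr_ile1 ?norm_conjC.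
by rewrite normrM ler_piMr ?norm_conjC.
Qed.

Definition subseqs t u : seq V := [seq x.1 - x.2 | x <- zip t u].

(** The derivatives are along the side lengths of the box. *)
Lemma cube_translates (g : V -> C) t u x : size t = size u ->
  cube t u (fun v => g (x + \sum_(w <- v) w)) =
  mders (subseqs t u) g (x + \sum_(w <- u) w).
Proof.
elim: t u g x => [|h t IH] [|k u] g x //= [tu].
under eq_cube => v do rewrite !big_cons.
rewrite -[RHS]mders_mder big_cons addrA -(IH _ (mder (h - k) g)) //.
apply: eq_cube => v; rewrite /mder; congr (g _ * (g _)^*).
  by rewrite -!addrA [_ + (h - k)]addrC [k + _]addrA [k + _]addrC subrK.
by rewrite addrA.
Qed.

(** All the factors of [mders t g x] but the one at the far vertex x + sum t:
    each of them misses some coordinate of t. *)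
Fixpoint mders_rest t (g : V -> C) x : C :=
  if t is h :: t' then mders_rest t' g (x + h) * (mders t' g x)^* else 1.

Lemma mders_restE t g x :
  mders t g x = g (x + \sum_(w <- t) w) * mders_rest t g x.
Proof.
elim: t x => [|h t IH] x /=; first by rewrite big_nil addr0 mulr1.
by rewrite /mder big_cons addrA mulrA -IH.
Qed.

Lemma low_mders_rest (Z : Type) s (g : Z -> V -> C) (x : Z -> V) :
  (forall z y, `|g z y| <= 1) -> low s (fun z t => mders_rest t (g z) (x z)).
Proof.
move=> g1; elim: s x => //= s IH x.
exists (fun z t => (mders t (g z) (x z))^*),
  (fun h z t => mders_rest t (g z) (x z + h)); split=> [z h t|z t|h].
- by rewrite mulrC.
- by rewrite norm_conjC; apply: mders_bound.
- exact: (IH (fun z => x z + h)).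
Qed.

End BoxCauchySchwarz.
Lemma mean_subseqs (C : numClosedFieldType) (V : finZmodType) s (phi : seq V -> C) :
  \mean_(t : s.-tuple V) (\mean_(u : s.-tuple V) phi (subseqs t u)) =
  \mean_(k : s.-tuple V) phi k.
Proof.
elim: s phi => [|s IH] phi.
  rewrite (mean_tuple0 (fun t => \mean_(u : 0.-tuple V) phi (subseqs t u))).
  rewrite (mean_tuple0 (fun u => phi (subseqs [::] u))).
  by rewrite (mean_tuple0 phi).
rewrite (mean_tupleS s (fun t => \mean_(u : s.+1.-tuple V) phi (subseqs t u))).
rewrite (mean_tupleS s phi).
under eq_mean => h do under eq_mean => t do
  rewrite (mean_tupleS s (fun u => phi (subseqs (h :: t) u))).
under eq_mean => h do rewrite mean_exchange.
under eq_mean => h do under eq_mean => k do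
  rewrite (IH (fun v => phi (h - k :: v))).
rewrite mean_exchange.
under eq_mean => k do
  rewrite -(mean_shift (- k) (fun h => \mean_(v : s.-tuple V) phi (h :: v))).
rewrite mean_const //.
by rewrite (cardD1 0) inE.
Qed.

(** * Additive characters *)

Section Characters.
Variables (C : numClosedFieldType) (F : finFieldType) (e : F -> C).

Definition addchar :=
  [/\ {morph e : x y / x + y >-> x * y}, forall x, `|e x| = 1
    & exists x, e x != 1].

Hypothesis e_char : addchar.

Lemma addcharD x y : e (x + y) = e x * e y.
Proof. by case: e_char => eD _ _. Qed.

Lemma norm_addchar x : `|e x| = 1.
Proof. by case: e_char. Qed.

Lemma addchar_neq0 x : e x != 0.
Proof. by rewrite -normr_eq0 norm_addchar oner_eq0. Qed.

Lemma addchar0 : e 0 = 1.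
Proof. by apply: (mulfI (addchar_neq0 0)); rewrite -addcharD addr0 mulr1. Qed.

Lemma addcharN x : e (- x) = (e x)^*.
Proof.
apply: (mulfI (addchar_neq0 x)).
by rewrite -addcharD subrr addchar0 -normCK norm_addchar expr1n.
Qed.

Lemma addcharB x y : e (x - y) = e x * (e y)^*.
Proof. by rewrite addcharD addcharN. Qed.

Lemma mean_addchar0 : mean e = 0.
Proof.
case: e_char => _ _ [a ea1]; apply/eqP.
have h : mean e = mean e * e a.
  rewrite [LHS](mean_shift a) -mean_mulr; apply: eq_mean => x.
  by rewrite addcharD.
have /eqP : mean e * (1 - e a) = 0 by rewrite mulrBr mulr1 -h subrr.
by rewrite mulf_eq0 subr_eq0 [1 == _]eq_sym (negPf ea1) orbF.
Qed.

Lemma mean_addchar xi : \mean_(x : F) e (xi * x) = (xi == 0)%:R.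
Proof.
have [->|xi0] := eqVneq xi 0.
  under eq_mean => x do rewrite mul0r addchar0.
  by rewrite mean_const // (cardD1 0) inE.
by rewrite -(mean_reindex e (mulfI xi0)) mean_addchar0.
Qed.

Definition fourier (g : F -> C) xi := \mean_(x : F) (g x * e (xi * x)).

Definition corr (g : F -> C) h := mean (mder h g).

Lemma fourier_corr g xi : `|fourier g xi| ^+ 2 = fourier (corr g) xi.
Proof.
rewrite norm_mean_corr; apply: eq_mean => h.
rewrite -mean_mulr; apply: eq_mean => x.
rewrite mulrDr addcharD rmorphM mulrACA; congr (_ * _).
by rewrite mulrAC -normCK norm_addchar expr1n mul1r.
Qed.

Lemma fourier_inv0 g : \sum_xi fourier g xi = g 0.
Proof.
have Fn0 : (#|F|%:R : C) != 0 by rewrite pnatr_eq0 -lt0n (cardD1 0) inE.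
rewrite -mean_sum.
under eq_mean => x do rewrite -mulr_sumr.
have sumE x : \sum_xi e (xi * x) = #|F|%:R * (x == 0)%:R :> C.
  rewrite -mean_addchar meanE mulVKf //.
  by apply: eq_bigr => xi _; rewrite mulrC.
under eq_mean => x do rewrite sumE.
rewrite meanE (bigD1 0) //= eqxx mulr1 big1 => [|x /negPf->].
  by rewrite addr0 [_ * #|F|%:R]mulrC mulKf.
by rewrite !mulr0.
Qed.

Lemma parseval g : \sum_xi `|fourier g xi| ^+ 2 = \mean_(x : F) `|g x| ^+ 2.
Proof.
under eq_bigr => xi _ do rewrite fourier_corr.
rewrite fourier_inv0; apply: eq_mean => x.
by rewrite /mder addr0 normCK.
Qed.

(** The inverse theorem for the Gowers norm of order 2: its fourth power is the
    sum of the fourth powers of the absolute values of the Fourier coefficients,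
    and by Parseval their squares sum to at most 1. *)
Lemma fourier_inverse g : (forall x, `|g x| <= 1) ->
  exists xi, \mean_(h : F) `|corr g h| ^+ 2 <= `|fourier g xi| ^+ 2.
Proof.
move=> g1; set M := mean _; pose v xi := `|fourier g xi| ^+ 2.
have v0 xi : 0 <= v xi by rewrite exprn_ge0.
have M0 : 0 <= M by apply: mean_ge0 => h; rewrite exprn_ge0.
have ME : M = \sum_xi v xi * v xi.
  rewrite /M -parseval; apply: eq_bigr => xi _.
  by rewrite -fourier_corr ger0_norm ?v0 // expr2.
have v1 : \sum_xi v xi <= 1.
  by rewrite parseval; apply: mean_le_const => // x; rewrite exprn_ile1.
have [/existsP//|] := boolP [exists xi, M <= v xi].
rewrite negb_exists => /forallP noxi; exfalso.
have vM xi : v xi < M by rewrite real_ltNge ?ger0_real // noxi.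
have Mv0 xi : 0 <= v xi * (M - v xi) by rewrite mulr_ge0 // subr_ge0 ltW.
have : \sum_xi v xi * (M - v xi) = 0.
  apply/eqP; rewrite eq_le sumr_ge0 // andbT.
  under eq_bigr => xi _ do rewrite mulrBr.
  by rewrite sumrB -mulr_suml -ME subr_le0 ler_piMl.
move/eqP; rewrite psumr_eq0 // => /allP allz.
have z xi : v xi = 0.
  have := allz xi (mem_index_enum _); rewrite mulf_eq0 subr_eq0 => /orP[/eqP//|].
  by rewrite gt_eqF ?vM.
have := vM 0; rewrite ME big1 ?z ?ltxx // => xi _; by rewrite z mul0r.
Qed.

(** The phase of a [cube] of characters: see [cube_addchar]. *)
Fixpoint dcube t u (phi : seq F -> F) : F :=
  match t, u with
  | h :: t', k :: u' => dcube t' u' (fun v => phi (h :: v) - phi (k :: v))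
  | _, _ => phi [::]
  end.

Lemma dcubeB t u phi psi : dcube t u (fun v => phi v - psi v) =
  dcube t u phi - dcube t u psi.
Proof.
have eq_dcube t' u' p q : p =1 q -> dcube t' u' p = dcube t' u' q.
  elim: t' u' p q => [|h t' IH] [|k u'] p q pq //=.
  by apply: IH => v; rewrite !pq.
elim: t u phi psi => [|h t IH] [|k u] phi psi //=.
by rewrite -IH; apply: eq_dcube => v; rewrite !opprB addrACA [RHS]addrACA [- _ - _]addrC.
Qed.

Lemma cube_addchar t u phi x :
  cube t u (fun v => e (phi v * x)) = e (dcube t u phi * x).
Proof.
elim: t u phi => [|h t IH] [|k u] phi //=.
by rewrite -IH; apply: eq_cube => v; rewrite -addcharB mulrBl.
Qed.

(** In [phi t - dcube t u phi] with u fixed, the value of [phi] at t cancels. Each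
    value that is left has an argument with some coordinate from u, and does not
    depend on the corresponding coordinate of t. *)
Lemma low_dcube (Z : Type) s u (phi : seq F -> F) (z : Z -> F) : size u = s ->
  low s (fun w t => e ((phi t - dcube t u phi) * z w)).
Proof.
elim: s u phi => [|s IH] [|k u] phi //=.
  by move=> _ w; rewrite subrr mul0r addchar0.
move=> [us].
exists (fun w t => e (dcube t u (fun v => phi (k :: v)) * z w)).
exists (fun h w t => e ((phi (h :: t) - dcube t u (fun v => phi (h :: v))) * z w)).
split=> [w h t|w t|h]; last exact: (IH u (fun t => phi (h :: t))).
  by rewrite -addcharD -mulrDl dcubeB opprB addrCA.
by rewrite norm_addchar.
Qed.

End Characters.

(** * Degree lowering *)

Section DegreeLowering.
Variables (C : numClosedFieldType) (F : finFieldType) (e : F -> C).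
Hypothesis e_char : addchar e.
Variables (Y : finType) (G : Y -> F -> C) (f : F -> C) (s : nat) (eta : C).
Hypothesis fE : forall x, f x = \mean_(y : Y) G y x.
Hypothesis G1 : forall y x, `|G y x| <= 1.
Hypothesis eta0 : 0 <= eta.
Hypothesis small_twist : forall t xi, size t = s -> xi != 0 ->
  `|\mean_(y : Y) (\mean_(x : F) (mders t (G y) x * e (xi * x)))| <= eta.

Let f1 x : `|f x| <= 1.
Proof. by rewrite fE norm_mean_le1. Qed.

(** A frequency for which [fourier_inverse] holds at the derivative along t. *)
Definition dual_freq t : F :=
  odflt 0 [pick xi | \mean_(h : F) `|corr (mders t f) h| ^+ 2 <=
                     `|fourier e (mders t f) xi| ^+ 2].

Definition dual_coef t : C := fourier e (mders t f) (dual_freq t).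

Let dual_coef1 t : `|dual_coef t| <= 1.
Proof.
apply: norm_mean_le1 => x; rewrite normrM (norm_addchar e_char) mulr1.
exact: mders_bound.
Qed.

Lemma dual_coefP t :
  \mean_(h : F) `|corr (mders t f) h| ^+ 2 <= `|dual_coef t| ^+ 2.
Proof.
rewrite /dual_coef /dual_freq; case: pickP => //= no.
have [xi] := fourier_inverse e_char (mders_bound t f1).
by rewrite no.
Qed.

Lemma gowers_le_dual_coef :
  gowers s.+1 f <= \mean_(t : s.-tuple F) `|dual_coef t| ^+ 2.
Proof.
rewrite gowersS mean_exchange; apply: ler_mean => t.
apply: le_trans (dual_coefP t); rewrite le_eqVlt; apply/orP; left; apply/eqP.
apply: eq_mean => h; congr (`|_| ^+ 2).
by apply: eq_mean => x; rewrite mders_mder.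
Qed.

Let psi (t u : seq F) := dcube t u dual_freq.

Let resonant (t u : seq F) : C := (psi t u == 0)%:R.

(** Only the top factor of the derivatives of [f] is unfolded into its average
    over Y: the others are removed by [box_cauchy_schwarz], so that all the
    copies of [G] that remain share the same y. *)
Lemma dual_coef_resonance :
  (\mean_(t : s.-tuple F) `|dual_coef t| ^+ 2) ^+ (2 ^ s) <=
  \mean_(u : s.-tuple F) (\mean_(t : s.-tuple F)
     (`|dual_coef t| * resonant t u)) + eta.
Proof.
pose g (z : F * Y) t : C :=
  (dual_coef t)^* * e (dual_freq t * z.1) * G z.2 (z.1 + \sum_(w <- t) w).
pose b (z : F * Y) t : C := mders_rest t f z.1.
have alphaE : \mean_(t : s.-tuple F) `|dual_coef t| ^+ 2 =
    \mean_(z : F * Y) (\mean_(t : s.-tuple F) (g z t * b z t)).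
  rewrite mean_exchange; apply: eq_mean => t.
  rewrite normCK mulrC {2}/dual_coef /fourier -mean_mull mean_pair.
  apply: eq_mean => x; rewrite mders_restE fE -!mean_mulr -mean_mull.
  apply: eq_mean => y; rewrite /g /b /= -!mulrA; congr (_ * _).
  by rewrite [RHS]mulrCA; congr (_ * _); rewrite mulrC.
have bl : low s b.
  exact: (@low_mders_rest _ _ _ s (fun _ => f) (fun z => z.1)).
have := box_cauchy_schwarz g bl; rewrite -alphaE ger0_norm; last first.
  by apply: mean_ge0 => t; rewrite exprn_ge0.
move=> h; apply: (le_trans h); rewrite {h alphaE bl b}.
rewrite mean_exchange -[X in _ + X](@mean_const _ (s.-tuple F)); last first.
  by rewrite card_tuple expn_gt0 (cardD1 0) inE.
rewrite -meanD; apply: ler_mean => u.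
rewrite -[X in _ + X](@mean_const _ (s.-tuple F)); last first.
  by rewrite card_tuple expn_gt0 (cardD1 0) inE.
rewrite -meanD; apply: ler_mean => t.
have tu : size t = size u by rewrite !size_tuple.
set K := cube t u (fun v => (dual_coef v)^*).
have K1 : `|K| <= `|dual_coef t|.
  have conj1 v : `|(dual_coef v)^*| <= 1 by rewrite norm_conjC.
  by have := norm_cube tu conj1; rewrite norm_conjC.
set c := \sum_(w <- u) w.
pose M := \mean_(y : Y) (\mean_(x : F)
  (mders (subseqs t u) (G y) x * e (psi t u * x))).
have -> : \mean_(z : F * Y) cube t u (g z) = K * (e (psi t u * c))^* * M.
  rewrite mean_pair mean_exchange /M -mean_mull; apply: eq_mean => y.
  rewrite [in RHS](mean_shift c) -mean_mull; apply: eq_mean => x.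
  rewrite /g !cubeM -/K /= (cube_addchar e_char) -/(psi t u) cube_translates // -/c.
  rewrite mulrDr (addcharD e_char) -!mulrA; congr (_ * _).
  rewrite [RHS]mulrCA [(e (_ * c))^* * _]mulrCA -normCKC (norm_addchar e_char).
  by rewrite expr1n mulr1 mulrC.
rewrite !normrM norm_conjC (norm_addchar e_char) mulr1.
have M1 : `|M| <= 1.
  apply: norm_mean_le1 => y; apply: norm_mean_le1 => x.
  by rewrite normrM (norm_addchar e_char) mulr1 mders_bound.
apply: (@le_trans _ _ (`|dual_coef t| * `|M|)); first by rewrite ler_wpM2r.
rewrite /resonant; have [_|psi0] := eqVneq (psi t u) 0.
  by rewrite mulr1 (le_trans (ler_piMr _ M1)) // lerDl.
rewrite mulr0 add0r (le_trans (ler_piMl _ (dual_coef1 t))) // small_twist //.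
by rewrite size_map size_zip !size_tuple minnn.
Qed.

(** By [low_dcube] the phase is removed by Cauchy-Schwarz together with the other
    lower-order factors, and only a Gowers norm of [f] remains. *)
Lemma low_freq_gowers (u : s.-tuple F) :
  (\mean_(t : s.-tuple F)
     `|fourier e (mders t f) (dual_freq t - psi t u)| ^+ 2) ^+ (2 ^ s)
  <= gowers s f.
Proof.
pose Phi t := dual_freq t - psi t u.
pose g (z : F * F) (t : seq F) : C := mder z.1 f (z.2 + \sum_(w <- t) w).
pose b (z : F * F) t : C :=
  mders_rest t (mder z.1 f) z.2 * e (Phi t * z.1).
have bl : low s b.
  apply: lowM; last by apply: (low_dcube e_char); rewrite size_tuple.
  by apply: low_mders_rest => z; apply: mder_bound.
have sumE : \mean_(t : s.-tuple F) `|fourier e (mders t f) (Phi t)| ^+ 2 =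
    \mean_(z : F * F) (\mean_(t : s.-tuple F) (g z t * b z t)).
  rewrite mean_exchange; apply: eq_mean => t.
  rewrite (fourier_corr e_char) mean_pair; apply: eq_mean => h.
  rewrite -mean_mulr; apply: eq_mean => x.
  by rewrite mulrA -mders_restE mders_mder.
have := box_cauchy_schwarz g bl; rewrite -sumE ger0_norm; last first.
  by apply: mean_ge0 => t; rewrite exprn_ge0.
move=> h; apply: (le_trans h); rewrite {h sumE bl b}.
suff tuE (t v : s.-tuple F) : \mean_(z : F * F) cube t v (g z) =
    `|mean (mders (subseqs t v) f)| ^+ 2.
  under eq_mean => t do under eq_mean => v do
    rewrite tuE ger0_norm ?exprn_ge0 //.
  rewrite (mean_subseqs s (fun k => `|mean (mders k f)| ^+ 2)).
  exact: lexx.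
rewrite -mean_mder_sqr mean_pair; apply: eq_mean => h.
rewrite [RHS](mean_shift (\sum_(w <- v) w)); apply: eq_mean => x.
by rewrite /g cube_translates ?size_tuple //= mders_mder.
Qed.

(** For u fixed, a frequency at t is resonant when it agrees with
    [dual_freq t - psi t u]; there [low_freq_gowers] applies. *)
Lemma degree_lowering_step : eta <= 1 ->
  dom eta (s + s.+1) ((2 * 1) ^ (2 ^ s.+1) * 2) (gowers s.+1 f) (gowers s f).
Proof.
move=> eta1.
set beta := \mean_(u : s.-tuple F) (\mean_(t : s.-tuple F)
     (`|dual_coef t| * resonant t u)).
have beta0 : 0 <= beta.
  by do 2!apply: mean_ge0 => ?; rewrite mulr_ge0 // ler0n.
have g0 := gowers_ge0 s f.
have dom1 : dom eta s 1 (gowers s.+1 f) beta.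
  rewrite /dom mul1r; apply: le_trans dual_coef_resonance.
  by rewrite lerXn2r ?nnegrE ?gowers_ge0 ?gowers_le_dual_coef // mean_ge0 // => t;
    rewrite exprn_ge0.
have dom2 : dom eta s.+1 1 beta (gowers s f).
  rewrite /dom mul1r expnS exprM.
  apply: (@le_trans _ _ ((\mean_(u : s.-tuple F) \mean_(t : s.-tuple F)
     `|fourier e (mders t f) (dual_freq t - psi t u)| ^+ 2) ^+ (2 ^ s))).
    rewrite lerXn2r ?nnegrE ?exprn_ge0 //.
      by do 2!apply: mean_ge0 => ?; rewrite exprn_ge0.
    rewrite -[beta]ger0_norm //; apply: (le_trans (norm_mean_sqr _)).
    apply: ler_mean => u; apply: (le_trans (norm_mean_sqr _)).
    apply: ler_mean => t; rewrite /resonant.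
    have [->|_] := eqVneq (psi t u) 0; last first.
      by rewrite mulr0 normr0 expr0n exprn_ge0.
    by rewrite mulr1 normr_id subr0.
  apply: (le_trans (mean_exp2 s _)) => [u|].
    by apply: mean_ge0 => t; rewrite exprn_ge0.
  apply: (@le_trans _ _ (gowers s f)); last by rewrite lerDl.
  by apply: mean_le_const => // u; apply: low_freq_gowers.
exact: (dom_trans eta0 eta1 (gowers_ge0 _ _) beta0 g0 dom1 dom2).
Qed.

End DegreeLowering.

(** Iteration of the step down to the lowest order, where [gowers 0] is the
    square of the absolute value of the mean. *)
Lemma degree_lowering (C : numClosedFieldType) s : exists n K,
  forall (F : finFieldType) (e : F -> C), addchar e ->
  forall (Y : finType) (G : Y -> F -> C) (eta : C),
    (forall y x, `|G y x| <= 1) -> 0 <= eta -> eta <= 1 ->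
    (forall t xi, xi != 0 ->
      `|\mean_(y : Y) (\mean_(x : F) (mders t (G y) x * e (xi * x)))| <= eta) ->
  dom eta n K (gowers s (fun x => \mean_(y : Y) G y x))
              (gowers 0 (fun x => \mean_(y : Y) G y x)).
Proof.
elim: s => [|s [n [K IH]]].
  by exists 0%N, 1%N => F e _ Y G eta _ eta0 _ _; rewrite /dom mul1r lerDl.
eexists; eexists=> F e e_char Y G eta G1 eta0 eta1 small.
apply: (dom_trans eta0 eta1 (gowers_ge0 _ _) (gowers_ge0 _ _) (gowers_ge0 _ _)).
  by apply: (degree_lowering_step e_char) => // t xi _; apply: small.
exact: (IH F e e_char Y G eta G1 eta0 eta1 small).
Qed.

(** * Shifts of polynomials *)

Section Translates.
Variable F : fieldType.
Implicit Types (P Q : {poly F}) (h : F).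

Definition shiftp h P := P \Po ('X + h%:P).

Lemma horner_shiftp h P y : (shiftp h P).[y] = P.[y + h].
Proof. by rewrite horner_comp !hornerE. Qed.

Lemma size_shiftp h P : size (shiftp h P) = size P.
Proof. by rewrite size_comp_poly2 // size_XaddC. Qed.

Lemma shiftpB h P Q : shiftp h (P - Q) = shiftp h P - shiftp h Q.
Proof. exact: comp_polyB. Qed.

Lemma shiftp_shift h k P : shiftp h P = shiftp k (shiftp (h - k) P).
Proof.
rewrite /shiftp -comp_polyA comp_polyD comp_polyX comp_polyC -addrA -polyCD.
by rewrite [k + _]addrC subrK.
Qed.

Lemma coef_shiftp h P n : (size P <= n.+1)%N -> (shiftp h P)`_n = P`_n.
Proof.
elim/poly_ind: P n => [|P c IH] n; first by rewrite /shiftp comp_poly0.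
move=> szP; have {}szP : (size P <= n)%N.
  move: szP; rewrite size_MXaddC; case: ifP => // /andP[/eqP-> _].
  by rewrite size_poly0.
rewrite /shiftp comp_poly_MXaddC -/(shiftp h P) mulrDr !coefD coefMX coefMC.
rewrite coefMX !coefC; case: n szP => [|n] szP /=.
  move: szP; rewrite leqn0 size_poly_eq0 => /eqP->.
  by rewrite /shiftp comp_poly0 coef0 mul0r addr0.
by rewrite IH // [(shiftp _ _)`_n.+1]nth_default ?size_shiftp // mul0r !addr0.

Qed.

Lemma coef_shiftp2 h P n : (size P <= n.+2)%N ->
  (shiftp h P)`_n = P`_n + n.+1%:R * h * P`_n.+1.
Proof.
elim/poly_ind: P n => [|P c IH] n.
  by rewrite /shiftp comp_poly0 !coef0 mulr0 addr0.
move=> szP; have {}szP : (size P <= n.+1)%N.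
  move: szP; rewrite size_MXaddC; case: ifP => // /andP[/eqP-> _].
  by rewrite size_poly0.
rewrite /shiftp comp_poly_MXaddC -/(shiftp h P) mulrDr !coefD !coefMX coefMC.
rewrite !coefC /=; case: n szP => [|n] szP /=.
  by rewrite (coef_shiftp _ szP) !add0r mul1r addr0 addrC mulrC.
rewrite IH // (coef_shiftp _ szP) !addr0 -addrA; congr (_ + _).
by rewrite -[n.+2%:R]natr1 !mulrDl mul1r [P`__ * h]mulrC.
Qed.

(** The coefficient of the derivative in degree deg P - 1 is
    deg P * h * lead_coef P, so the degree has to be invertible in the field. *)
Lemma size_diffp h P : h != 0 -> (size P).-1%:R != 0 :> F ->
  size (shiftp h P - P) = (size P).-1.
Proof.
move=> h0; case sP: (size P) => [|[|n]] /=; rewrite ?eqxx // => n0.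
have coefn : (shiftp h P - P)`_n = n.+1%:R * h * P`_n.+1.
  by rewrite coefB coef_shiftp2 ?sP // addrC addKr.
apply/eqP; rewrite eqn_leq; apply/andP; split.
  apply/leq_sizeP => j; rewrite leq_eqVlt => /orP[/eqP<-|nj].
    by rewrite coefB coef_shiftp ?sP // subrr.
  by rewrite coefB !nth_default ?subr0 ?size_shiftp ?sP.
rewrite ltnNge; apply/negP => /leq_sizeP/(_ n (leqnn n))/eqP.
rewrite coefn mulf_eq0 mulf_eq0 (negPf n0) (negPf h0) /=.
by have := lead_coef_eq0 P; rewrite lead_coefE sP /= => ->; rewrite -size_poly_eq0 sP.
Qed.

End Translates.

(** * Linear configurations *)

Section Counting.
Variables (C : numClosedFieldType) (F : finFieldType).

Definition family := seq ({poly F} * (F -> C)).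
Implicit Types (s : family) (b : F -> C).

Definition bounded (f : F -> C) : bool := [forall x, `|f x| <= 1].

Lemma boundedP f : reflect (forall x, `|f x| <= 1) (bounded f).
Proof. exact: forallP. Qed.

Definition fbounded s := all (fun q => bounded q.2) s.

Definition fprod s x y := \prod_(q <- s) q.2 (x + q.1.[y]).

Definition counting s b := \mean_(x : F) (\mean_(y : F) (fprod s x y * b y)).

Lemma norm_fprod s x y : fbounded s -> `|fprod s x y| <= 1.
Proof.
elim: s => [|q s IH] /=; first by rewrite /fprod big_nil normr1.
by move=> /andP[/boundedP q1 /IH]; rewrite /fprod big_cons normrM => ?; rewrite mulr_ile1.
Qed.

Lemma norm_counting s b : fbounded s -> bounded b -> `|counting s b| <= 1.
Proof.
move=> s1 /boundedP b1; do 2!apply: norm_mean_le1 => ?.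
by rewrite normrM mulr_ile1 // norm_fprod.
Qed.

Lemma bounded_mder h f : bounded f -> bounded (mder h f).
Proof. by move=> /boundedP f1; apply/boundedP => x; apply: mder_bound. Qed.

Lemma bounded_conj f : bounded f -> bounded (fun x => (f x)^*).
Proof. by move=> /boundedP f1; apply/boundedP => x; rewrite norm_conjC. Qed.

(** For each y, x is replaced by x - R(y). *)
Lemma counting_translate (R : {poly F}) s b :
  counting s b = counting [seq (q.1 - R, q.2) | q <- s] b.
Proof.
rewrite /counting mean_exchange [RHS]mean_exchange; apply: eq_mean => y.
rewrite (mean_shift (- R.[y])); apply: eq_mean => x; congr (_ * _).
rewrite /fprod big_map; apply: eq_bigr => q _ /=.
by rewrite hornerD hornerN addrA [in RHS]addrAC.
Qed.

Definition linear_term (q : {poly F} * (F -> C)) : bool := (size q.1 <= 2)%N.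

Lemma horner_linear (P : {poly F}) y h : (size P <= 2)%N ->
  P.[y + h] = P.[y] + P`_1 * h.
Proof.
move=> szP; rewrite !(@horner_coef_wide _ 2 _ _ szP) !big_ord_recl !big_ord0 /=.
by rewrite /bump /= !expr1 !addr0 !expr0 mulrDr addrA.
Qed.

(** Translating makes the first form constant in y, so that Cauchy-Schwarz in x
    removes its function; as all the forms are linear, the two copies of each
    other function combine into a derivative. *)
Lemma linear_vdc q s b : all linear_term (q :: s) -> bounded q.2 ->
  `|counting (q :: s) b| ^+ 2 <=
  \mean_(h : F) `|counting
     [seq (r.1 - q.1, mder ((r.1 - q.1)`_1 * h) r.2) | r <- s] (mder h b)|.
Proof.
move=> lin /boundedP q1; rewrite (counting_translate q.1) /= subrr.
set s' := [seq _ | _ <- s].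
have -> : counting ((0, q.2) :: s') b =
    \mean_(x : F) (q.2 x * \mean_(y : F) (fprod s' x y * b y)).
  apply: eq_mean => x; rewrite -mean_mull; apply: eq_mean => y.
  by rewrite /fprod big_cons horner0 addr0 mulrA.
apply: (le_trans (mean_mul_sqr _ q1)); rewrite vdc.
rewrite -[leLHS]ger0_norm; last first.
  by rewrite -vdc; apply: mean_ge0 => x; rewrite exprn_ge0.
apply: (le_trans (ler_norm_mean _)); rewrite le_eqVlt; apply/orP; left.
apply/eqP; apply: eq_mean => h; congr (`|_|).
apply: eq_mean => x; apply: eq_mean => y.
rewrite rmorphM mulrACA; congr (_ * _).
move: lin => /= /andP[linq lins].
have {lins} : all linear_term s' .
  rewrite all_map; apply: sub_all lins => r; rewrite /linear_term /= => linr.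
  by apply: (leq_trans (size_polyD _ _)); rewrite geq_max linr size_polyN.
rewrite {}/s'; elim: s => [|r s IH] /=; first by rewrite /fprod !big_nil rmorph1 mulr1.
move=> /andP[linr /IH]; rewrite /fprod !big_cons rmorphM mulrACA => ->.
congr (_ * _); rewrite /mder /= (@horner_linear (r.1 - q.1)) //.
by rewrite addrA.
Qed.

End Counting.

Section GoodShifts.
Variable C : numClosedFieldType.

(** For a bounded number of exceptional shifts only the trivial bound holds; they
    cost an error of size O(1/|F|). *)
Lemma dom_mean (F : finFieldType) n K k (B : pred F) a (g : F -> C) b :
  0 <= a -> 0 <= b -> (#|B| <= k)%N -> (forall h, 0 <= g h) ->
  (forall h, g h <= 1) -> a ^+ 2 <= mean g ->
  (forall h, ~~ B h -> dom #|F|%:R^-1 n K (g h) b) ->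
  dom #|F|%:R^-1 (1 + n) ((2 * k.+1) ^ (2 ^ n) * K.+1) a b.
Proof.
move=> a0 b0 Bk g0 g1 ag gb; set eps := _^-1.
have eps0 : 0 <= eps by rewrite invr_ge0 ler0n.
have F0 : (0 < #|F|)%N by rewrite (cardD1 0) inE.
have eps1 : eps <= 1 by rewrite invf_le1 ?ltr0n // ler1n.
pose g' h := if B h then 0 else g h.
have g'0 h : 0 <= g' h by rewrite /g'; case: ifP.
apply: (dom_trans eps0 eps1 a0 (mean_ge0 g'0) b0); last first.
  apply: (le_trans (mean_exp2 n g'0)); apply: mean_le_const => [|h].
    by rewrite mulr_ge0 ?ler0n // addr_ge0.
  rewrite /g'; case: ifP => [_|/negbT/gb//].
  by rewrite expr0n expn_eq0 /= mulr_ge0 ?ler0n // addr_ge0.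
rewrite /dom expn1; apply: (le_trans ag).
have gE : mean g <= mean g' + k%:R * eps.
  have -> : k%:R * eps = eps * (k%:R : C) by rewrite mulrC.
  rewrite !meanE -/eps -mulrDr ler_wpM2l //.
  apply: (@le_trans _ _ (\sum_h (g' h + (B h)%:R))).
    by apply: ler_sum => h _; rewrite /g'; case: (B h); rewrite ?add0r ?addr0.
  rewrite big_split lerD2l -natr_sum ler_nat (leq_trans _ Bk) //.
  rewrite -sum1_card [leqRHS]big_mkcond /=; apply: leq_sum => h _.
  by rewrite unfold_in; case: (B h).
apply: (le_trans gE); rewrite -natr1 mulrDr mulrDl mul1r.
apply: lerD; first by rewrite lerDr mulr_ge0 ?ler0n ?mean_ge0.
by rewrite mulrDl mul1r lerDl.
Qed.

(** Exponential sums over linear configurations: each round removes a function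
    and lowers the degree of the phase by 1, so the functions are exhausted
    before the phase becomes constant. *)
Lemma weyl D : exists n K, forall (F : finFieldType) (e : F -> C), addchar e ->
  (forall i, (0 < i <= D.+1)%N -> i%:R != 0 :> F) ->
  forall (s : family C F) (Q : {poly F}), all (@linear_term C F) s -> fbounded s ->
  (size s < size Q)%N -> (1 < size Q <= D.+2)%N ->
  dom #|F|%:R^-1 n K `|counting s (fun y => e Q.[y])| 0.
Proof.
elim: D => [|D [n [K IH]]].
  exists 0%N, 0%N => F e e_char _ s Q lin _ szs.
  rewrite -eqn_leq eq_sym => /eqP szQ; rewrite szQ ltnS in szs.
  suff -> : counting s (fun y => e Q.[y]) = 0 by rewrite /dom normr0 expr0n mul0r.
  have Q0 : \mean_(y : F) e Q.[y] = 0.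
    have Q1 : Q`_1 != 0.
      by have := lead_coef_eq0 Q; rewrite lead_coefE szQ /= -size_poly_eq0 szQ => ->.
    have QE y : Q.[y] = Q.[0] + Q`_1 * y by rewrite -horner_linear ?szQ ?add0r.
    under eq_mean => y do rewrite QE (addcharD e_char).
    by rewrite mean_mull mean_addchar // (negPf Q1) mulr0.
  rewrite /counting mean_exchange; case: s lin szs => [|q [|//]] lin _.
    under eq_mean => y do under eq_mean => x do rewrite /fprod big_nil mul1r.
    rewrite mean_exchange; under eq_mean => x do rewrite Q0.
    by rewrite mean0.
  have qE y : \mean_(x : F) (fprod [:: q] x y * e Q.[y]) = mean q.2 * e Q.[y].
    rewrite mean_mulr [in RHS](mean_shift q.1.[y]); congr (_ * _).
    by apply: eq_mean => x; rewrite /fprod big_seq1.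
  under eq_mean => y do rewrite qE.
  by rewrite mean_mull Q0 mulr0.
eexists; eexists => F e e_char charF s Q lin s1 szs /andP[Q1 szQ].
have e1 R : bounded (fun y => e R.[y]).
  by apply/boundedP => y; rewrite (norm_addchar e_char).
move: szQ; rewrite leq_eqVlt => /orP[/eqP szQ|szQ]; last first.
  apply: (@dom_le _ _ n (1 + n) K ((2 * 2) ^ (2 ^ n) * K.+1)) => //.
  - by rewrite invr_ge0 ler0n.
  - exact: norm_counting.
  - by rewrite (leq_trans (leqnSn K)) // leq_pmull // expn_gt0.
  apply: IH => //; last by rewrite Q1.
  by move=> i /andP[i0 iD]; apply: charF; rewrite i0 ltnW.
rewrite szQ in szs; wlog [q [s' sE]] : s lin s1 szs / exists q s', s = q :: s'.
  case: s lin s1 szs => [|q s'] lin s1 szs H; last by apply: H => //; exists q, s'.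
  (* Without functions, the constant 1 serves as the one to remove. *)
  have := H [:: (0, fun _ => 1)]; rewrite /counting /fprod /= /linear_term.
  rewrite size_poly0 /= andbT.
  have b1 : bounded (fun _ : F => 1 : C) by apply/boundedP => x; rewrite normr1.
  rewrite b1 => /(_ isT isT isT).
  have -> : \mean_(x : F) (\mean_(y : F) (\prod_(q <- [:: (0, fun _ => 1)])
     q.2 (x + q.1.[y]) * e Q.[y])) =
     \mean_(x : F) (\mean_(y : F) (\prod_(q <- [::] : family C F)
     q.2 (x + q.1.[y]) * e Q.[y])).
    by apply: eq_mean => x; apply: eq_mean => y; rewrite big_seq1 big_nil.
  by apply; exists (0, fun _ => 1), [::].
subst s; move: (s1) => /= /andP[q1 s'1].
pose s'' h := [seq (r.1 - q.1, mder ((r.1 - q.1)`_1 * h) r.2) | r <- s'].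
have vE h : counting (s'' h) (mder h (fun y => e Q.[y])) =
    counting (s'' h) (fun y => e (shiftp h Q - Q).[y]).
  apply: eq_mean => x; apply: eq_mean => y; congr (_ * _).
  by rewrite /mder !hornerE horner_shiftp (addcharB e_char).
have s''1 h : fbounded (s'' h).
  rewrite /fbounded all_map; apply: sub_all s'1 => r /=; exact: bounded_mder.
apply: (@dom_mean F n K 1 (pred1 0) _
  (fun h => `|counting (s'' h) (fun y => e (shiftp h Q - Q).[y])|)) => //.
- by rewrite card1.
- by move=> h; apply: norm_counting.
- apply: (le_trans (linear_vdc _ lin q1)); rewrite le_eqVlt; apply/orP; left.
  by apply/eqP; apply: eq_mean => h; rewrite vE.
move=> h h0; apply: IH => //.
- by move=> i /andP[i0 iD]; apply: charF; rewrite i0 ltnW.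
- move: lin => /= /andP[linq lins].
  rewrite all_map; apply: sub_all lins => r; rewrite /linear_term /= => linr.
  by apply: (leq_trans (size_polyD _ _)); rewrite geq_max linr size_polyN.
- by rewrite size_map size_diffp // szQ //= charF //= ltnS leqnn.
- by rewrite size_diffp // szQ /= ?leqnn // charF //= ltnS leqnn.
Qed.

End GoodShifts.

(** * PET induction *)

Section LexInduction.

Definition lexlt d (w' w : nat -> nat) : Prop :=
  exists e, [/\ (0 < e <= d)%N, (w' e < w e)%N
    & forall i, (e < i)%N -> w' i = w i].

Lemma lex_ind d (X : (nat -> nat) -> Prop) :
  (forall w, (forall w', lexlt d w' w -> X w') -> X w) -> forall w, X w.
Proof.
move=> step.
suff claim k w : (k <= d)%N -> (forall w', (exists e, [/\ (k < e <= d)%N,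
    (w' e < w e)%N & forall i, (e < i)%N -> w' i = w i]) -> X w') -> X w.
  move=> w; apply: (claim d w) => // w' [e []].
  by move=> /andP[de ed]; rewrite leqNgt de in ed.
elim: k w => [|k IH] w kd; first exact: step.
move: {2}(w k.+1) (leqnn (w k.+1)) => v; elim: v w => [|v IHv] w wv below.
  apply: IH; first exact: ltnW.
  move=> w' [e [/andP[ke ed] w'e ew']]; apply: below.
  exists e; split=> //; rewrite ed andbT ltn_neqAle ke andbT.
  by apply: contraTneq w'e => <-; rewrite -leqNgt (leq_trans wv).
apply: IH; first exact: ltnW.
move=> w' [e [/andP[ke ed] w'e ew']].
have [ek|ek] := eqVneq e k.+1; last first.
  apply: below; exists e; split=> //.
  by rewrite ed andbT ltn_neqAle ke andbT eq_sym.
subst e; apply: IHv; first by rewrite -ltnS (leq_trans w'e).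
move=> w'' [e [/andP[ke' ed'] w''e ew'']]; apply: below.
exists e; split=> [||i ei]; first by rewrite ke'.
  by rewrite -ew'.
by rewrite ew'' // ew' // (ltn_trans ke').
Qed.

End LexInduction.

Section LeadingCoefs.
Variable F : fieldType.
Implicit Types (P R : {poly F}) (L : seq {poly F}).

Definition leads e L := undup [seq lead_coef q | q : {poly F} <- L & size q == e.+1].

Definition nleads e L := size (leads e L).

Lemma nleads_size e L : (nleads e L <= size L)%N.
Proof.
rewrite (leq_trans (size_undup _)) // size_map size_filter count_size //.
Qed.

Definition pet_polys R h L :=
  [seq shiftp h u - R | u <- L] ++ [seq u - R | u <- L].

(** Subtracting R moves the leading coefficients in degree e by the coefficient
    of R there, and no new ones appear since R has minimal degree. *)
Lemma leads_step e R h L : (size R <= e.+1)%N ->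
  (forall u, u \in L -> size R <= size u)%N ->
  {subset leads e (pet_polys R h L) <= [seq c - R`_e | c <- leads e L]}.
Proof.
move=> Re RL c; rewrite mem_undup => /mapP[v]; rewrite mem_filter mem_cat.
have main (u v' : {poly F}) : u \in L -> size v' = size u ->
    ((size u <= e.+1)%N -> v'`_e = u`_e) -> size (v' - R) == e.+1 ->
    lead_coef (v' - R) \in [seq c - R`_e | c <- leads e L].
  move=> uL v'u v'ue /eqP sz.
  have su : size u = e.+1.
    have := RL u uL; rewrite leq_eqVlt => /orP[/eqP Ru|Ru]; last first.
      by rewrite -sz size_polyDl ?v'u // size_polyN.
    apply/eqP; rewrite eqn_leq -{1}Ru Re /= -sz.
    by rewrite (leq_trans (size_polyD _ _)) // size_polyN v'u Ru maxnn.
  apply/mapP; exists (lead_coef u).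
    by rewrite mem_undup map_f // mem_filter su eqxx.
  by rewrite !lead_coefE sz su /= coefB v'ue // su.
move=> /andP[vsz /orP[/mapP[u uL vE]|/mapP[u uL vE]]] ->; subst v.
  apply: (main u) => //; first exact: size_shiftp.
  by move=> ?; rewrite coef_shiftp.
exact: (main u).
Qed.

Lemma nleads_step_le e R h L : (size R <= e.+1)%N ->
  (forall u, u \in L -> size R <= size u)%N ->
  (nleads e (pet_polys R h L) <= nleads e L)%N.
Proof.
move=> Re RL; rewrite /nleads -(size_map (fun c => c - R`_e) (leads e L)).
by apply: uniq_leq_size; [apply: undup_uniq|apply: leads_step].
Qed.

(** Subtracting R removes the class of R: its leading coefficient would become
    zero. *)
Lemma nleads_step_lt e R h L : size R = e.+1 -> R \in L ->
  (forall u, u \in L -> size R <= size u)%N ->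
  (nleads e (pet_polys R h L) < nleads e L)%N.
Proof.
move=> Re RL minR; rewrite /nleads -(size_map (fun c => c - R`_e) (leads e L)).
rewrite -[X in (X <= _)%N]/(size (0 :: leads e (pet_polys R h L))).
apply: uniq_leq_size.
  rewrite /= undup_uniq andbT mem_undup; apply/negP => /mapP[v].
  rewrite mem_filter => /andP[/eqP sv _] /esym/eqP.
  by rewrite lead_coef_eq0 -size_poly_eq0 sv.
move=> c; rewrite inE => /orP[/eqP->|]; last by apply: leads_step; first rewrite Re.
apply/mapP; exists (lead_coef R); last by rewrite lead_coefE Re subrr.
by rewrite mem_undup map_f // mem_filter Re eqxx.
Qed.

(** The polynomial to subtract has to be of minimal degree, so that the leading
    coefficients of higher degree are left alone, and it must keep P of maximal
    degree. One of minimal degree among those that do not cancel the leading term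
    of P does both. If every polynomial cancels it, all are of the same degree,
    and P itself serves: shifting and subtracting lowers all the degrees, that of
    P by exactly 1. *)
Lemma pet_choice P (qs : seq {poly F}) :
  (1 < size P)%N -> (size P).-1%:R != 0 :> F ->
  all (fun q : {poly F} => size q <= size P)%N qs ->
  let L := P :: [seq q : {poly F} <- qs | (1 < size q)%N] in
  exists R, [/\ R \in L, forall u : {poly F}, (u \in L -> size R <= size u)%N
    & forall h u, h != 0 -> u \in L ->
      (size (shiftp h u - R)%R <= size (shiftp h P - R)%R)%N /\
      (size (u - R)%R <= size (shiftp h P - R)%R)%N].
Proof.
move=> P1 Pchar maxP; set L := _ :: _ => /=.
have L1 (u : {poly F}) : u \in L -> (1 < size u)%N.
  by rewrite inE => /orP[/eqP->//|]; rewrite mem_filter => /andP[].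
have LP (u : {poly F}) : u \in L -> (size u <= size P)%N.
  rewrite inE => /orP[/eqP->//|]; rewrite mem_filter => /andP[_].
  exact: (allP maxP).
have [d dP] : exists d, size P = d.+2 by case: (size P) P1 => [|[|d]] //; exists d.
have [/hasP[R0 R0L R0P]|/hasPn noR] := boolP (has (fun q => size (P - q)%R == size P) L).
  have ex : exists n, has (fun q => (size (P - q)%R == size P) && (size q == n)) L.
    by exists (size R0); apply/hasP; exists R0; rewrite ?R0P ?eqxx.
  case: (ex_minnP ex) => n /hasP[R RL /andP[/eqP RP /eqP Rn]] minn.
  exists R; split=> // [u uL|h u h0 uL].
    have [uP|uP] := eqVneq (size (P - u)) (size P).
      by rewrite Rn; apply: minn; apply/hasP; exists u => //; rewrite uP !eqxx.
    have uPsz : size u = size P.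
      apply/eqP; rewrite eqn_leq LP //= leqNgt; apply: contra uP => uP.
      by rewrite size_polyDl // size_polyN.
    by rewrite uPsz LP.
  have szP' : size (shiftp h P - R) = size P.
    apply/eqP; rewrite eqn_leq; apply/andP; split.
      rewrite (leq_trans (size_polyD _ _)) // geq_max size_shiftp leqnn size_polyN.
      exact: LP.
    rewrite dP ltnNge; apply/negP => /leq_sizeP/(_ d.+1 (leqnn _)).
    rewrite coefB coef_shiftp ?dP // -coefB => /eqP.
    have -> : (P - R)`_d.+1 = lead_coef (P - R) by rewrite lead_coefE RP dP.
    by rewrite lead_coef_eq0 -size_poly_eq0 RP dP.
  rewrite szP'; split; rewrite (leq_trans (size_polyD _ _)) // geq_max size_polyN;
    by rewrite ?size_shiftp !LP.
have cancel (u : {poly F}) : u \in L -> (size (P - u)%R <= d.+1)%N.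
  move=> uL; rewrite -ltnS -dP ltn_neqAle noR //= (leq_trans (size_polyD _ _)) //.
  by rewrite size_polyN geq_max leqnn LP.
exists P; split=> [|u uL|h u h0 uL]; first by rewrite inE eqxx.
  rewrite leqNgt; apply/negP => uP; have := noR u uL.
  by rewrite size_polyDl ?eqxx // size_polyN.
have dsz (v : {poly F}) : (size v <= size P)%N -> v`_d.+1 = P`_d.+1 -> (size (v - P)%R <= d.+1)%N.
  move=> vP vPd; apply/leq_sizeP => j; rewrite leq_eqVlt => /orP[/eqP<-|dj].
    by rewrite coefB vPd subrr.
  by rewrite coefB !nth_default ?subr0 ?dP // (leq_trans vP) ?dP.
have ud : u`_d.+1 = P`_d.+1.
  have /leq_sizeP/(_ d.+1 (leqnn _)) := cancel u uL.
  by rewrite coefB => /eqP; rewrite subr_eq0 => /eqP->.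
rewrite size_diffp // dP /=; split; apply: dsz; rewrite ?size_shiftp ?LP //.
by rewrite coef_shiftp // (leq_trans (LP _ _)) ?dP.
Qed.

End LeadingCoefs.

Section PetStep.
Variables (C : numClosedFieldType) (F : finFieldType).
Implicit Types (s l : family C F) (P R : {poly F}) (f : F -> C).

Definition bad_shifts P (L : seq {poly F}) : pred F :=
  fun h => has (fun q => size (shiftp h P - q)%R <= 1)%N L.

(** If two shifts of P differed from q by constants, then P would differ from a
    nontrivial shift of itself by a constant. *)
Lemma card_bad_shifts P L : (2 < size P)%N -> (size P).-1%:R != 0 :> F ->
  (#|bad_shifts P L| <= size L)%N.
Proof.
move=> P2 Pchar; elim: L => [|q L IH].
  by rewrite leqn0; apply/eqP; apply: eq_card0 => h.
pose B1 : pred F := fun h => (size (shiftp h P - q)%R <= 1)%N.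
have B1_1 : (#|B1| <= 1)%N.
  apply/card_le1_eqP => h k; rewrite !unfold_in /B1 => hB kB.
  apply/esym/eqP; rewrite -subr_eq0; apply: contraLR (P2) => hk; rewrite -leqNgt.
  rewrite -(prednK (ltnW (ltnW P2))) ltnS -(size_diffp hk Pchar).
  rewrite -(size_shiftp k) shiftpB -shiftp_shift.
  have -> : shiftp h P - shiftp k P = (shiftp h P - q) - (shiftp k P - q).
    by rewrite opprB addrA subrK.
  by rewrite (leq_trans (size_polyD _ _)) // size_polyN geq_max hB.
rewrite (leq_trans _ (leq_add B1_1 IH)) // -cardUI.
by rewrite (leq_trans _ (leq_addr _ _)).
Qed.

Definition fpolys s : seq {poly F} := [seq q.1 | q <- s].

Definition nonconst s : family C F := [seq q : {poly F} * (F -> C) <- s | (1 < size q.1)%N].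

Definition pet_family R h s : family C F :=
  [seq (shiftp h q.1 - R, q.2) | q <- s] ++
  [seq (q.1 - R, fun x => (q.2 x)^*) | q <- s].

Lemma fpolys_pet R h s : fpolys (pet_family R h s) = pet_polys R h (fpolys s).
Proof. by rewrite /fpolys /pet_polys map_cat -!map_comp. Qed.

Lemma fbounded_pet R h s : fbounded s -> fbounded (pet_family R h s).
Proof.
move=> s1; rewrite /fbounded all_cat !all_map; apply/andP; split => //.
by apply: sub_all s1 => q /= /bounded_conj.
Qed.

(** Before Cauchy-Schwarz in x the functions with constant polynomials are split
    off: otherwise they would contribute the new leading coefficient of - R. *)
Lemma pet_vdc R s : fbounded s ->
  `|counting s (fun=> 1)| ^+ 2 <=
  \mean_(h : F) `|counting (pet_family R h (nonconst s)) (fun=> 1)|.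
Proof.
move=> s1; pose B x := \prod_(q <- s | (size (q.1 : {poly F}) <= 1)%N) q.2 (x + q.1`_0).
have B1 x : `|B x| <= 1.
  rewrite /B {B}; elim: s s1 => [|q s IH] /=; first by rewrite big_nil normr1.
  move=> /andP[/boundedP q1 /IH]; rewrite big_cons; case: ifP => // _ ?.
  by rewrite normrM mulr_ile1.
have -> : counting s (fun=> 1) =
    \mean_(x : F) (B x * \mean_(y : F) fprod (nonconst s) x y).
  apply: eq_mean => x; rewrite -mean_mull; apply: eq_mean => y.
  rewrite mulr1 /fprod.
  rewrite (bigID (fun q : {poly F} * (F -> C) => (size q.1 <= 1)%N)) /=.
  congr (_ * _).
    by apply: eq_bigr => q /size1_polyC->; rewrite hornerC coefC.
  by rewrite big_filter; apply: eq_bigl => q; rewrite ltnNge.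
apply: (le_trans (mean_mul_sqr _ B1)); rewrite vdc.
rewrite -[leLHS]ger0_norm; last first.
  by rewrite -vdc; apply: mean_ge0 => x; rewrite exprn_ge0.
apply: (le_trans (ler_norm_mean _)); rewrite le_eqVlt; apply/orP; left.
apply/eqP; apply: eq_mean => h; congr (`|_|).
rewrite -[pet_family _ _ _](_ : [seq (q.1 - R, q.2) | q <-
   [seq (shiftp h q.1, q.2) | q <- nonconst s] ++
   [seq (q.1, fun x => (q.2 x)^*) | q <- nonconst s]] = _); last first.
  by rewrite map_cat -!map_comp.
rewrite -counting_translate; apply: eq_mean => x; apply: eq_mean => y.
rewrite mulr1 /fprod big_cat !big_map rmorph_prod; congr (_ * _).
by apply: eq_bigr => q _; rewrite horner_shiftp.
Qed.

(** For linear forms the removed function does not reappear, and each round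
    differentiates [f] once more. *)
Lemma linear_gowers s P f : all (@linear_term C F) ((P, f) :: s) -> fbounded s ->
  bounded f -> all (fun q => 1 < size (P - q.1)%R)%N s ->
  `|counting ((P, f) :: s) (fun=> 1)| ^+ (2 ^ (size s).+1) <= gowers (size s) f.
Proof.
move: {2}(size s) (erefl (size s)) => n; elim: n s P f => [|n IH] [|q s] P f //=.
  move=> _ _ _ _ _; rewrite gowers0 expn1 /counting mean_exchange.
  under eq_mean => y do under eq_mean => x do rewrite mulr1 /fprod big_seq1.
  under eq_mean => y do rewrite -(mean_shift P.[y]).
  by rewrite mean_const // (cardD1 0) inE.
move=> [sn] /and3P[linP linq lins] /andP[q1 s1] f1 /andP[Pq Ps].
have -> : counting ((P, f) :: q :: s) (fun=> 1) =
    counting (q :: (P, f) :: s) (fun=> 1).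
  by apply: eq_mean => x; apply: eq_mean => y; rewrite /fprod !big_cons mulrCA.
have linS : all (@linear_term C F) (q :: (P, f) :: s) by rewrite /= linq linP.
have := linear_vdc (fun=> 1) linS q1 => /=.
set rho := (P - q.1)`_1 => vdc_q.
pose s' h := [seq (r.1 - q.1, mder ((r.1 - q.1)`_1 * h) r.2) | r <- s].
have size_sub (R : {poly F}) : (size R <= 2)%N -> (size (R - q.1)%R <= 2)%N.
  by move=> R2; rewrite (leq_trans (size_polyD _ _)) // geq_max R2 size_polyN.
have rho0 : rho != 0.
  have sz2 : size (P - q.1) = 2 by apply/eqP; rewrite eqn_leq size_sub.
  have -> : rho = lead_coef (P - q.1) by rewrite lead_coefE sz2.
  by rewrite lead_coef_eq0 -size_poly_eq0 sz2.
rewrite expnS exprM.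
apply: (@le_trans _ _ ((\mean_(h : F)
    `|counting ((P - q.1, mder (rho * h) f) :: s' h) (fun=> 1)|) ^+ (2 ^ n.+2.-1))).
  rewrite sn lerXn2r ?nnegrE ?exprn_ge0 //; first exact: mean_ge0.
  apply: (le_trans vdc_q); rewrite le_eqVlt; apply/orP; left; apply/eqP.
  apply: eq_mean => h; congr (`|_|); apply: eq_mean => x; apply: eq_mean => y.
  by rewrite /mder rmorph1 mulr1.
apply: (le_trans (mean_exp2 _ _)) => //; rewrite sn gowersS.
rewrite [leRHS](mean_reindex _ (mulfI rho0)); apply: ler_mean => h /=.
have <- : size (s' h) = n by rewrite size_map.
apply: IH.
- by rewrite size_map.
- rewrite /= /linear_term /= size_sub //= all_map; apply: sub_all lins => r.
  exact: size_sub.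
- by rewrite /fbounded all_map; apply: sub_all s1 => r /=; apply: bounded_mder.
- exact: bounded_mder.
- rewrite all_map; apply: sub_all Ps => r /=.
  by rewrite opprB addrA subrK.
Qed.

End PetStep.

Section Pet.
Variable C : numClosedFieldType.

(** The bound depends on the class of the polynomials only, not on their
    coefficients or on the field: the induction runs over classes. *)
Definition controlled d (cls : forall F : finFieldType, {poly F} -> seq {poly F} -> bool)
    s n K : Prop :=
  forall (F : finFieldType), (forall i, (0 < i <= d)%N -> i%:R != 0 :> F) ->
  forall (P : {poly F}) (f : F -> C) (l : family C F),
    cls F P (fpolys l) -> (1 < size P <= d.+1)%N ->
    all (fun q : {poly F} => size q <= size P)%N (fpolys l) ->
    all (fun q => 1 < size (P - q)%R)%N (fpolys l) ->
    bounded f -> fbounded l ->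
    dom #|F|%:R^-1 n K `|counting ((P, f) :: l) (fun=> 1)| (gowers s f).

Lemma inv_card_ge0 (F : finFieldType) : 0 <= #|F|%:R^-1 :> C.
Proof. by rewrite invr_ge0 ler0n. Qed.

Lemma inv_card_le1 (F : finFieldType) : #|F|%:R^-1 <= 1 :> C.
Proof.
have F0 : (0 < #|F|)%N by rewrite (cardD1 0) inE.
by rewrite invf_le1 ?ltr0n // ler1n.
Qed.

Lemma controlled_le d cls s s' n n' K K' : (s <= s')%N ->
  (n + (s' - s) <= n')%N -> ((2 * K) ^ (2 ^ (s' - s)) * 2 <= K')%N ->
  controlled d cls s n K -> controlled d cls s' n' K'.
Proof.
move=> ss' nn' KK' ctl F charF P f l c szP maxP dP f1 l1.
have a1 : `|counting ((P, f) :: l) (fun=> 1)| <= 1.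
  apply: norm_counting; first by rewrite /fbounded /= f1.
  by apply/boundedP => x; rewrite normr1.
apply: (dom_le _ _ a1 _ nn' KK'); rewrite ?inv_card_ge0 ?gowers_ge0 //.
apply: (dom_trans _ (inv_card_le1 F) _ (gowers_ge0 s f) _ (ctl F charF P f l c szP maxP dP f1 l1));
  rewrite ?inv_card_ge0 ?gowers_ge0 //.
rewrite /dom mul1r (le_trans (gowers_exp2 _ _ _)) // subnKC // lerDl.
exact: inv_card_ge0.
Qed.

(** Finitely many classes share their constants; this is used to choose the
    constants before the degree of the subtracted polynomial is known. *)
Lemma controlled_uniform d D
    (cls : nat -> forall F : finFieldType, {poly F} -> seq {poly F} -> bool) :
  (forall e, (e < D)%N -> exists s n K, controlled d (cls e) s n K) ->
  exists s n K, forall e, (e < D)%N -> controlled d (cls e) s n K.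
Proof.
elim: D => [|D IH] h; first by exists 0%N, 0%N, 0%N.
have [e eD|s1 [n1 [K1 ctl1]]] := IH; first by apply: h; apply: ltnW.
have [s2 [n2 [K2 ctl2]]] := h D (leqnn _).
pose s := maxn s1 s2; pose n := maxn (n1 + (s - s1)) (n2 + (s - s2)).
exists s, n, (maxn ((2 * K1) ^ (2 ^ (s - s1)) * 2) ((2 * K2) ^ (2 ^ (s - s2)) * 2)).
move=> e; rewrite ltnS leq_eqVlt => /orP[/eqP->|eD].
  by apply: (controlled_le _ _ _ ctl2); rewrite ?leq_maxr.
by apply: (controlled_le _ _ _ (ctl1 e eD)); rewrite ?leq_maxl.
Qed.

Definition pet_class d N (w : nat -> nat) (F : finFieldType) (P : {poly F}) qs :=
  (size qs <= N)%N && all (fun e => nleads e (P :: qs) <= w e)%N (iota 1 d).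

(** PET induction. After one step the number of distinct leading coefficients in
    the degree of the subtracted polynomial drops, while the numbers for higher
    degrees do not grow; those for lower degrees are bounded by the size of the
    new family. Thus the vector of these numbers decreases lexicographically,
    until P is linear. *)
Lemma pet d N w : exists s n K, controlled d (pet_class d N w) s n K.
Proof.
elim/(@lex_ind d): w N => w IH N.
pose w' e := fun i => if (e < i)%N then w i else
  if i == e then (w e).-1 else (2 * N.+1)%N.
(* Class e holds the families after a step that subtracts a polynomial of degree
   e; class 0 is for the families that are linear from the start. *)
pose cls e := fun (F : finFieldType) (P : {poly F}) qs =>
  if e == 0%N then (size P <= 2)%N && (size qs <= N)%N
  else (0 < w e)%N && pet_class d (2 * N.+1) (w' e) P qs.
have [e ed|s [n [K ctl]]] := @controlled_uniform d d.+1 cls.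
  have [->|e0] := eqVneq e 0%N.
  exists N, N.+1, 1%N => F charF P f l /andP[P2 lN] szP maxP dP f1 l1.
    rewrite size_map in lN.
    have lin : all (@linear_term C F) ((P, f) :: l).
      rewrite /= {1}/linear_term P2 /=; move: maxP; rewrite all_map; apply: sub_all.
      by move=> q /= qP; apply: leq_trans P2.
    have dP' : all (fun q => 1 < size (P - q.1)%R)%N l by rewrite all_map in dP.
    have := linear_gowers lin l1 f1 dP'.
    set a := `|_| => ag; rewrite /dom mul1r.
    have -> : N.+1 = ((size l).+1 + (N - size l))%N by rewrite addSn subnKC.
    rewrite expnD exprM.
    apply: (@le_trans _ _ (gowers (size l) f ^+ (2 ^ (N - size l)))).
      by rewrite lerXn2r ?nnegrE ?exprn_ge0 ?gowers_ge0 /a.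
    rewrite (le_trans (gowers_exp2 _ _ _)) // subnKC // lerDl.
    exact: inv_card_ge0.
  have [we|we] := posnP (w e).
    exists 0%N, 0%N, 0%N => F charF P f l.
    by rewrite /cls (negPf e0) we.
  have lw : lexlt d (w' e) w.
    exists e; split=> [||i ei]; first by rewrite lt0n e0.
      by rewrite /w' ltnn eqxx prednK.
    by rewrite /w' ei.
  have [s [n [K ctl]]] := IH _ lw (2 * N.+1)%N.
  exists s, n, K => F charF P f l; rewrite /cls (negPf e0) we /=.
  exact: ctl.
exists s, (1 + n)%N, ((2 * N.+2) ^ (2 ^ n) * K.+1)%N.
move=> F charF P f l cl /andP[P1 Pd] maxP dP f1 l1.
move: (cl) => /andP[lN /allP weights].
have [P2|P2] := leqP (size P) 2.
  have ctl0 := ctl 0%N isT F charF P f l.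
  have := ctl0; rewrite /cls /= P2 lN P1 Pd => /(_ isT isT maxP dP f1 l1).
  move=> ad; apply: (dom_le _ _ _ _ _ _ ad) => //.
  - exact: inv_card_ge0.
  - by apply: norm_counting => //; [rewrite /fbounded /= f1|apply/boundedP => x; rewrite normr1].
  - exact: gowers_ge0.
  - by rewrite (leq_trans (leqnSn K)) // leq_pmull // expn_gt0.
have Pchar : (size P).-1%:R != 0 :> F.
  by apply: charF; rewrite -subn1 subn_gt0 P1 leq_subLR.
set s0 := (P, f) :: l; have s01 : fbounded s0 by rewrite /fbounded /= f1.
have s0nc : fbounded (nonconst s0).
  by rewrite /fbounded all_filter; apply: sub_all s01 => q /= q1; rewrite q1 implybT.
have [R [RL minR sizeR]] := pet_choice P1 Pchar maxP.
have LE : fpolys (nonconst s0) = P :: [seq q : {poly F} <- fpolys l | (1 < size q)%N].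
  by rewrite /nonconst /= P1 /= /fpolys filter_map.
rewrite -LE in RL minR sizeR.
have szL : (size (fpolys (nonconst s0)) <= N.+1)%N.
  by rewrite LE /= ltnS (leq_trans _ lN) // size_filter count_size.
have L1 (u : {poly F}) : u \in fpolys (nonconst s0) -> (1 < size u)%N.
  by rewrite LE inE => /orP[/eqP->//|]; rewrite mem_filter => /andP[].
pose e := (size R).-1.
have Re : size R = e.+1 by rewrite prednK // ltnW // L1.
have PL : P \in fpolys (nonconst s0) by rewrite LE inE eqxx.
have e0 : (0 < e)%N by rewrite -ltnS -Re L1.
have ed : (0 < e <= d)%N.
  by rewrite e0 -ltnS -Re (leq_trans (minR P PL)).
have eL i : (0 < i <= d)%N -> (nleads i (fpolys (nonconst s0)) <= w i)%N.
  move=> /andP[i0 id]; apply: leq_trans (weights i _); last by rewrite mem_iota i0 add1n ltnS.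
  rewrite LE /nleads /leads -[P :: fpolys l]/(fpolys s0).
  have -> : P :: [seq q : {poly F} <- fpolys l | (1 < size q)%N] =
      [seq q : {poly F} <- fpolys s0 | (1 < size q)%N] by rewrite /= P1.
  rewrite -filter_predI (@eq_filter _ _ (fun q : {poly F} => size q == i.+1)) // => q /=.
  by case: eqP => // ->; rewrite ltnS i0.
have we : (0 < w e)%N.
  by rewrite (leq_trans _ (eL e ed)) // (leq_ltn_trans _ (nleads_step_lt 0 Re RL minR)).
apply: (@dom_mean C F n K N.+1 (bad_shifts P (fpolys (nonconst s0))) _
  (fun h => `|counting (pet_family R h (nonconst s0)) (fun=> 1)|)) => //.
- exact: gowers_ge0.
- by rewrite (leq_trans (card_bad_shifts _ P2 Pchar)).
- move=> h; apply: norm_counting; last by apply/boundedP => x; rewrite normr1.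
  exact: fbounded_pet.
- exact: pet_vdc.
move=> h /hasPn good; have {}good (u : {poly F}) : u \in fpolys (nonconst s0) ->
    (1 < size (shiftp h P - u)%R)%N by move=> /good; rewrite -ltnNge.
have h0 : h != 0.
  by apply: contraTneq (good P PL) => ->; rewrite /shiftp addr0 comp_polyXr subrr size_poly0.
pose l' := [seq (shiftp h q.1 - R, q.2) | q <- nonconst l] ++
  [seq (q.1 - R, fun x => (q.2 x)^*) | q <- nonconst s0].
have famE : pet_family R h (nonconst s0) = (shiftp h P - R, f) :: l'.
  by rewrite /pet_family /l' /nonconst /= P1.
have polysE : shiftp h P - R :: fpolys l' = pet_polys R h (fpolys (nonconst s0)).
  by rewrite -fpolys_pet famE.
have inl' (v : {poly F}) : v \in fpolys l' ->
    v \in pet_polys R h (fpolys (nonconst s0)) by rewrite -polysE inE orbC => ->.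
rewrite famE; apply: (ctl e); first by rewrite ltnS; case/andP: ed.
- exact: charF.
- rewrite /cls gtn_eqF // we andTb /pet_class; apply/andP; split.
    have lnc : (size (nonconst l) <= N)%N.
      by rewrite (leq_trans _ lN) // /fpolys size_map size_filter count_size.
    rewrite /fpolys size_map size_cat !size_map /= P1 /= mul2n -addnn leq_add //.
    exact: leqW.
  apply/allP => i; rewrite mem_iota add1n ltnS => id; rewrite polysE /w'.
  case: ltngtP => ie.
  - by rewrite (leq_trans (nleads_step_le _ _ minR)) ?eL // Re ltnW.
  - rewrite (leq_trans (nleads_size _ _)) // size_cat !size_map.
    by rewrite addnn -mul2n leq_mul2l /= -(size_map fst).
  - by rewrite -ie -ltnS prednK // (leq_trans (nleads_step_lt _ Re RL minR)) ?eL.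
- rewrite good //=; apply: (leq_trans (size_polyD _ _)).
  by rewrite geq_max size_shiftp size_polyN Pd (leq_trans (minR P PL)).
- apply/allP => v /inl'; rewrite mem_cat => /orP[] /mapP[u uL ->].
    by case: (sizeR h u h0 uL).
  by case: (sizeR h u h0 uL).
- rewrite /fpolys all_map all_cat !all_map; apply/andP; split.
    rewrite all_filter; rewrite /fpolys all_map in dP; apply: sub_all dP.
    move=> q /= Pq; apply/implyP => _.
    by rewrite opprB addrA subrK -shiftpB size_shiftp.
  have : all (fun u : {poly F} => 1 < size (shiftp h P - R - (u - R))%R)%N
      (fpolys (nonconst s0)).
    by apply/allP => u /good; rewrite opprB addrA subrK.
  by rewrite /fpolys all_map.
- exact: f1.
- have := @fbounded_pet C F R h (nonconst s0).
  by rewrite famE => /(_ s0nc) /andP[].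
Qed.

End Pet.

(** * Gowers norm control of weighted counts *)

Section Control.
Variable C : numClosedFieldType.

(** A weight depending on y only is removed by Cauchy-Schwarz in y; this costs
    one derivative, that is, one more order of the Gowers norm. *)
Lemma gowers_control d N : exists s n K,
  forall (F : finFieldType), (forall i, (0 < i <= d)%N -> i%:R != 0 :> F) ->
  forall (P : {poly F}) (f : F -> C) (l : family C F) (b : F -> C),
    (size l <= N)%N -> (1 < size P <= d.+1)%N ->
    all (fun q : {poly F} => size q <= size P)%N (fpolys l) ->
    all (fun q => 1 < size (P - q)%R)%N (fpolys l) ->
    bounded f -> fbounded l -> bounded b ->
    dom #|F|%:R^-1 n K `|counting ((P, f) :: l) b| (gowers s f).
Proof.
have [s [n [K ctl]]] := pet C d N (fun=> N.+1).
exists s.+1, n.+1, K => F charF P f l b lN szP maxP dP f1 l1 /boundedP b1.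
pose l' (z : F) : family C F := [seq (q.1, mder z q.2) | q <- l].
have polysE z : fpolys (l' z) = fpolys l by rewrite /fpolys -map_comp.
have ctlz z : dom #|F|%:R^-1 n K
    `|counting ((P, mder z f) :: l' z) (fun=> 1)| (gowers s (mder z f)).
  apply: ctl; rewrite ?polysE //.
  - rewrite /pet_class /fpolys size_map lN; apply/allP => e _.
    by rewrite (leq_trans (nleads_size _ _)) //= size_map ltnS.
  - exact: bounded_mder.
  - by rewrite /fbounded all_map; apply: sub_all l1 => q /=; apply: bounded_mder.
have vdcE : `|counting ((P, f) :: l) b| ^+ 2 <=
    \mean_(z : F) `|counting ((P, mder z f) :: l' z) (fun=> 1)|.
  rewrite /counting mean_exchange.
  under [X in `|X|]eq_mean => y do under eq_mean => x do rewrite mulrC.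
  under [X in `|X|]eq_mean => y do rewrite mean_mull.
  apply: (le_trans (mean_mul_sqr _ b1)); rewrite vdc.
  rewrite -[leLHS]ger0_norm; last first.
    by rewrite -vdc; apply: mean_ge0 => x; rewrite exprn_ge0.
  apply: (le_trans (ler_norm_mean _)); rewrite le_eqVlt; apply/orP; left.
  apply/eqP; apply: eq_mean => z; congr (`|_|); rewrite mean_exchange.
  apply: eq_mean => x; apply: eq_mean => y; rewrite mulr1 /fprod !big_cons /=.
  rewrite rmorphM mulrACA; congr (_ * _); first by rewrite /mder addrAC.
  rewrite big_map rmorph_prod -big_split; apply: eq_bigr => q _ /=.
  by rewrite /mder addrAC.
rewrite /dom expnS exprM.
apply: (@le_trans _ _ ((\mean_(z : F)
  `|counting ((P, mder z f) :: l' z) (fun=> 1)|) ^+ (2 ^ n))).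
  by rewrite lerXn2r ?nnegrE ?exprn_ge0 ?mean_ge0.
apply: (le_trans (mean_exp2 _ _)) => //.
apply: (@le_trans _ _ (\mean_(z : F) (K%:R * (gowers s (mder z f) + #|F|%:R^-1)))).
  exact: ler_mean.
by rewrite mean_mull meanD mean_const ?gowersS // (cardD1 0) inE.
Qed.

Lemma dom_add (eps a1 a2 x : C) n1 n2 K1 K2 : 0 <= eps ->
  0 <= a1 -> a1 <= 1 -> 0 <= a2 -> a2 <= 1 -> 0 <= x -> x <= 2 * a1 + 2 * a2 ->
  dom eps n1 K1 a1 0 -> dom eps n2 K2 a2 0 ->
  dom eps (n1 + n2) (4 ^ (2 ^ (n1 + n2)) * (K1 + K2)) x 0.
Proof.
move=> e0 p1 l1 p2 l2 x0 xa d1 d2; set n := (n1 + n2)%N.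
have {}d1 : dom eps n K1 a1 0 by apply: dom_le d1; rewrite ?leq_addr.
have {}d2 : dom eps n K2 a2 0 by apply: dom_le d2; rewrite ?leq_addl.
rewrite /dom !add0r in d1 d2 *; move: d1 d2; set M := (2 ^ n)%N => d1 d2.
have t0 : 0 <= 2 * a1 + 2 * a2 by rewrite addr_ge0 ?mulr_ge0 ?ler0n.
apply: (@le_trans _ _ ((2 * a1 + 2 * a2) ^+ M)); first by rewrite lerXn2r ?nnegrE.
apply: (le_trans (addr_exp2 n _ _)); rewrite ?mulr_ge0 ?ler0n // -/M.
rewrite natrM natrX -mulrA !exprMn -mulrDr mulrA -exprMn -natrM.
rewrite ler_wpM2l ?exprn_ge0 ?ler0n // natrD mulrDl.
exact: lerD.
Qed.

End Control.

(** * The progression over a finite field *)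

Section Progression.
Variables (C : numClosedFieldType) (m : nat).

(** The functions of the linear terms are kept apart from those of the polynomial
    terms, since only the latter are replaced by their means. *)
Definition prog (F : finFieldType) (P : nat -> {poly F}) (g f : nat -> F -> C)
    (J : seq nat) : family C F :=
  [seq (j%:R *: 'X, g j) | j <- iota 0 m] ++ [seq (P j, f j) | j <- J].

(** The phase Q collects terms that have already become characters. It must stay
    independent of the terms that remain. *)
Definition nondeg (F : fieldType) (P : nat -> {poly F}) (J : seq nat)
    (Q : {poly F}) : Prop :=
  forall (c : F) (a : nat -> F), c != 0 \/ (exists2 j, j \in J & a j != 0) ->
  (m < size (c *: Q + \sum_(j <- J) a j *: P j)%R)%N.

Definition indep (F : fieldType) (P : nat -> {poly F}) (J : seq nat) : Prop :=
  forall a : nat -> F, (exists2 j, j \in J & a j != 0) ->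
  (m < size (\sum_(j <- J) a j *: P j)%R)%N.

Lemma nondeg_indep (F : fieldType) (P : nat -> {poly F}) J Q :
  nondeg P J Q -> indep P J.
Proof.
move=> nd a aJ; have := nd 0 a (or_intror aJ).
by rewrite scale0r add0r.
Qed.

Lemma sum_rem_update (F : fieldType) (P : nat -> {poly F}) J j0 c (a : nat -> F) :
  uniq J -> j0 \in J ->
  \sum_(j <- J) (if j == j0 then c else a j) *: P j =
  c *: P j0 + \sum_(j <- rem j0 J) a j *: P j.
Proof.
move=> uJ j0J; rewrite (perm_big _ (perm_to_rem j0J)) big_cons eqxx; congr (_ + _).
rewrite !big_seq; apply: eq_bigr => j.
by rewrite mem_rem_uniq // inE => /andP[/negPf-> _].
Qed.

Lemma indep_rem (F : fieldType) (P : nat -> {poly F}) J j0 xi :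
  uniq J -> j0 \in J -> xi != 0 -> indep P J ->
  nondeg P (rem j0 J) (xi *: P j0).
Proof.
move=> uJ j0J xi0 ind c a h; rewrite scalerA -sum_rem_update //; apply: ind.
case: h => [c0|[j]]; first by exists j0; rewrite ?eqxx ?mulf_neq0.
rewrite mem_rem_uniq // inE => /andP[jj0 jJ] aj.
by exists j; rewrite // (negPf jj0).
Qed.

Lemma nondeg_rem (F : fieldType) (P : nat -> {poly F}) J j0 xi Q :
  uniq J -> j0 \in J -> nondeg P J Q -> nondeg P (rem j0 J) (xi *: P j0 + Q).
Proof.
move=> uJ j0J nd c a h.
rewrite scalerDr scalerA [_ + c *: Q]addrC -addrA -sum_rem_update //; apply: nd.
case: h => [c0|[j]]; first by left.
rewrite mem_rem_uniq // inE => /andP[jj0 jJ] aj.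
by right; exists j; rewrite // (negPf jj0).
Qed.

Lemma max_degree (F : fieldType) (P : nat -> {poly F}) (J : seq nat) : J != [::] ->
  exists2 j0, j0 \in J & forall j, j \in J -> (size (P j) <= size (P j0))%N.
Proof.
elim: J => // i J IH _; have [->|/IH[j0 j0J maxJ]] := eqVneq J [::].
  by exists i; rewrite ?inE // => j; rewrite inE => /eqP->.
have [ij0|j0i] := leqP (size (P i)) (size (P j0)).
  exists j0; first by rewrite inE j0J orbT.
  by move=> j; rewrite inE => /orP[/eqP->//|]; apply: maxJ.
exists i; first by rewrite inE eqxx.
move=> j; rewrite inE => /orP[/eqP->//|/maxJ jj0].
by rewrite (leq_trans jj0) // ltnW.
Qed.

Section OneField.
Variables (F : finFieldType) (P : nat -> {poly F}).
Implicit Types (g f : nat -> F -> C) (J : seq nat) (b : F -> C).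

Lemma fprod_prog g f J x y : fprod (prog P g f J) x y =
  (\prod_(0 <= j < m) g j (x + j%:R * y)) * \prod_(j <- J) f j (x + (P j).[y]).
Proof.
rewrite /fprod big_cat !big_map /index_iota subn0; congr (_ * _).
by apply: eq_bigr => j _; rewrite hornerZ hornerX.
Qed.

Lemma fbounded_prog g f J : (forall j, bounded (g j)) -> (forall j, bounded (f j)) ->
  fbounded (prog P g f J).
Proof.
move=> g1 f1; rewrite /fbounded all_cat !all_map.
by apply/andP; split; apply/allP => j _ /=.
Qed.

Lemma counting_rem g f J b j0 : j0 \in J ->
  counting (prog P g f J) b =
  counting ((P j0, f j0) :: prog P g f (rem j0 J)) b.
Proof.
move=> j0J; apply: eq_mean => x; apply: eq_mean => y; congr (_ * _).
rewrite fprod_prog (perm_big _ (perm_to_rem j0J)) big_cons /= mulrCA.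
by rewrite -fprod_prog /fprod big_cons.
Qed.

(** Translating by P0 shows the average in y as the dual function. *)
Lemma counting_dual (P0 : {poly F}) (f0 : F -> C) l b :
  counting ((P0, f0) :: l) b =
  \mean_(x : F) (f0 x * \mean_(y : F) (b y *
     fprod [seq (q.1 - P0, q.2) | q <- l] x y)).
Proof.
rewrite (counting_translate P0); apply: eq_mean => x; rewrite -mean_mull.
apply: eq_mean => y; rewrite /fprod big_cons /= subrr horner0 addr0.
by rewrite -mulrA [in RHS](mulrC (b y)).
Qed.

Lemma mders_fprod t (l : family C F) y x : mders t (fun x => fprod l x y) x =
  fprod [seq (q.1, mders t q.2) | q <- l] x y.
Proof.
elim: l => [|q l IH].
  rewrite /fprod big_nil; under eq_mders => z do rewrite /fprod big_nil.
  by elim: t x => //= h t IH x; rewrite /mder !IH rmorph1 mulr1.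
rewrite /fprod /= big_cons /= -/(fprod _ x y) -IH -mders_shift -mdersM.
by apply: eq_mders => z; rewrite /fprod big_cons.
Qed.

Lemma fprod_translate (P0 : {poly F}) (l : family C F) x y :
  fprod [seq (q.1 - P0, q.2) | q <- l] (x + P0.[y]) y = fprod l x y.
Proof.
rewrite /fprod big_map; apply: eq_bigr => q _ /=.
by rewrite hornerD hornerN -addrA [P0.[y] + _]addrC subrK.
Qed.

(** The derivatives of the terms of the dual function, tested against a
    character, form again a count of the progression without its distinguished
    term. The latter has become part of the phase; the phase in x goes into the
    function of the term x itself. *)
Lemma counting_twist (e : F -> C) (P0 Q : {poly F}) g f J t xi :
  addchar e -> (0 < m)%N ->
  \mean_(y : F) (\mean_(x : F) (mders t (fun x => e Q.[y] *
     fprod [seq (q.1 - P0, q.2) | q <- prog P g f J] x y) x * e (xi * x))) =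
  counting (prog P
      (fun j => if j == 0 then fun x => mders t (g 0) x * e (xi * x)
                else mders t (g j))
      (fun j => mders t (f j)) J)
    (fun y => e (xi *: P0 + if t is [::] then Q else 0).[y]).
Proof.
move=> e_char m0; rewrite /counting [RHS]mean_exchange; apply: eq_mean => y.
rewrite (mean_shift P0.[y]); apply: eq_mean => x; rewrite mdersM mders_fprod.
pose L := prog P (fun j => mders t (g j)) (fun j => mders t (f j)) J.
have -> : [seq (q.1, mders t q.2) | q <- [seq (q.1 - P0, q.2) | q <- prog P g f J]]
    = [seq (q.1 - P0, q.2) | q <- L].
  by rewrite /L /prog !map_cat -!map_comp.
rewrite fprod_translate hornerD hornerZ mulrDr !(addcharD e_char).
have -> : mders t (fun=> e Q.[y]) (x + P0.[y]) =
    e (if t is [::] then Q else 0).[y].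
  elim: t (x + _) {L} => [|h t IH] z //=; rewrite horner0 (addchar0 e_char).
  by rewrite /mder !IH -normCK (norm_addchar e_char) expr1n.
have -> : fprod (prog P (fun j => if j == 0 then fun x => mders t (g 0) x * e (xi * x)
     else mders t (g j)) (fun j => mders t (f j)) J) x y = fprod L x y * e (xi * x).
  rewrite !fprod_prog mulrAC; congr (_ * _).
  rewrite !(big_ltn m0) /= mul0r addr0 -!mulrA; congr (_ * _).
  rewrite mulrC; congr (_ * _); rewrite !big_nat; apply: eq_bigr => j.
  by case: j.
rewrite -[LHS]mulrA mulrCA -[RHS]mulrA; congr (_ * _).
by rewrite mulrC mulrA.
Qed.

End OneField.

Section MeanZero.
Variables (d : nat) (m_gt0 : (0 < m)%N).

Definition vanishing ell n K : Prop :=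
  forall (F : finFieldType) (e : F -> C), addchar e ->
  (forall i, (0 < i <= d)%N -> i%:R != 0 :> F) ->
  forall (P : nat -> {poly F}) (g f : nat -> F -> C) (J : seq nat) (Q : {poly F}),
  size J = ell -> uniq J -> (forall j, j \in J -> (size (P j) <= d.+1)%N) ->
  (size Q <= d.+1)%N -> nondeg P J Q ->
  (forall j, bounded (g j)) -> (forall j, bounded (f j)) ->
  dom #|F|%:R^-1 n K `|counting (prog P g f J) (fun y => e Q.[y])| 0.

Lemma mean_bool (f : bool -> C) : mean f = 2^-1 * (f true + f false).
Proof. by rewrite meanE card_bool big_bool. Qed.

(** Degree lowering differentiates kernels, so the mean of the dual function D has
    to be subtracted at their level: averaging over a sign as well, the kernels
    G_y and the constant - E D give (D - E D)/2. *)
Definition centered (F : finFieldType) (G : F -> F -> C) (z : F * bool) : F -> C :=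
  if z.2 then G z.1 else fun=> - \mean_(x : F) (\mean_(y : F) G y x).

Lemma mean_centered (F : finFieldType) (G : F -> F -> C) x :
  \mean_(z : F * bool) centered G z x =
  2^-1 * (\mean_(y : F) G y x - \mean_(x : F) (\mean_(y : F) G y x)).
Proof.
rewrite mean_pair; under eq_mean => y do rewrite mean_bool /centered /=.
rewrite mean_mull meanD mean_const // (cardD1 0) inE //.
Qed.

Definition dual_kernel (F : finFieldType) (e : F -> C) (P0 Q : {poly F})
    (l : family C F) y x : C :=
  e Q.[y] * fprod [seq (q.1 - P0, q.2) | q <- l] x y.

(** A derivative of a kernel twisted by a nontrivial character is again a count
    with one term less, whose phase is nontrivial; for the constant kernel the
    average is zero. Since [vanishing] bounds a power of these counts, the error
    [eta] of [degree_lowering] is a root. *)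
Lemma gowers_centered_small s : exists n2 K2, forall ell n K, vanishing ell n K ->
  forall (F : finFieldType) (e : F -> C), addchar e ->
  (forall i, (0 < i <= d)%N -> i%:R != 0 :> F) ->
  forall (P : nat -> {poly F}) (g f : nat -> F -> C) (J : seq nat)
    (P0 Q : {poly F}),
  size J = ell -> uniq J -> (forall j, j \in J -> (size (P j) <= d.+1)%N) ->
  (size P0 <= d.+1)%N -> (size Q <= d.+1)%N ->
  (forall xi, xi != 0 -> nondeg P J (xi *: P0)) ->
  (forall xi, xi != 0 -> nondeg P J (xi *: P0 + Q)) ->
  (forall j, bounded (g j)) -> (forall j, bounded (f j)) ->
  dom #|F|%:R^-1 (n2 + n) (K2.+1 ^ (2 ^ n) * K)
    (gowers s (fun x => \mean_(z : F * bool) centered (dual_kernel e P0 Q (prog P g f J)) z x)) 0.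
Proof.
have [n2 [K2 lower]] := degree_lowering C s.
exists n2, K2 => ell n K van F e e_char charF P g f J P0 Q sJ uJ szP szP0 szQ ndP ndPQ g1 f1.
set G := dual_kernel _ _ _ _.
set eps := _^-1; have eps0 : 0 <= eps by apply: inv_card_ge0.
set D := fun x => _; set gam := gowers s D.
have G1 y x : `|G y x| <= 1.
  rewrite normrM (norm_addchar e_char) mul1r; apply: norm_fprod.
  rewrite /fbounded all_map -[all _ _]/(fbounded _); exact: fbounded_prog.
have Gc1 z x : `|centered G z x| <= 1.
  rewrite /centered; case: z.2 => //; rewrite normrN.
  by do 2!apply: norm_mean_le1 => ?.
have D1 x : `|D x| <= 1 by apply: norm_mean_le1 => z.
have gam0 : 0 <= gam := gowers_ge0 _ _.
have [Ke1|Ke1] := real_leP (ger0_real (mulr_ge0 (ler0n C K) eps0)) (@real1 C); last first.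
  rewrite /dom add0r (@le_trans _ _ 1) ?exprn_ile1 ?gowers_le1 //.
  rewrite (le_trans (ltW Ke1)) // ler_wpM2r // ler_nat leq_pmull //.
  by rewrite expn_gt0.
have N0 : (0 < 2 ^ n)%N by rewrite expn_gt0.
(* If K * eps > 1 the claim was trivial, so eta is at most 1 here. *)
pose eta := (2 ^ n).-root (K%:R * eps).
have eta0 : 0 <= eta by rewrite rootC_ge0 // mulr_ge0 ?ler0n.
have etaK : eta ^+ (2 ^ n) = K%:R * eps by rewrite rootCK.
have eta1 : eta <= 1.
  by rewrite -(@ler_pXn2r _ (2 ^ n)) ?nnegrE // etaK expr1n.
have small t xi : xi != 0 -> `|\mean_(z : F * bool) (\mean_(x : F)
    (mders t (centered G z) x * e (xi * x)))| <= eta.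
  move=> xi0; rewrite mean_pair.
  have constE c : \mean_(x : F) (mders t (fun=> c) x * e (xi * x)) = 0.
    have cE x : mders t (fun=> c) x = mders t (fun=> c) 0.
      by elim: t x => //= h t IH x; rewrite /mder !(IH (_ + _)) (IH x).
    under eq_mean => x do rewrite cE.
    by rewrite mean_mull mean_addchar // (negPf xi0) mulr0.
  under eq_mean => y do rewrite mean_bool {2}/centered constE addr0.
  rewrite mean_mull normrM normfV normr_nat counting_twist //.
  set X := counting _ _.
  have Xeta : `|X| <= eta.
    rewrite -(@ler_pXn2r _ (2 ^ n)) ?nnegrE // etaK -[eps]add0r.
    apply: (van F e) => //.
    - rewrite (leq_trans (size_polyD _ _)) // geq_max.
      rewrite (leq_trans (size_scale_leq _ _)) //=.
      by case: (t); rewrite ?size_poly0.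
    - case: (t) => [|h t']; first exact: ndPQ.
      by rewrite addr0; apply: ndP.
    - move=> j; apply/boundedP => x; case: eqP => _; last first.
        by apply: mders_bound; apply/boundedP.
      by rewrite normrM (norm_addchar e_char) mulr1 mders_bound //; apply/boundedP.
    - by move=> j; apply/boundedP; apply: mders_bound; apply/boundedP.
  by rewrite (le_trans _ Xeta) // ler_piMl // invf_le1 ?ltr0n // ler1n.
have := lower F e e_char _ (centered G) eta Gc1 eta0 eta1 small.
rewrite -/D -/gam gowers0.
have -> : mean D = 0.
  rewrite /D; under eq_mean => x do rewrite mean_centered.
  rewrite mean_mull meanB [X in _ - X]mean_const ?subrr ?mulr0 //.
  by rewrite (cardD1 0) inE.
rewrite normr0 expr0n /= /dom !add0r => low.
rewrite expnD exprM natrM natrX -mulrA -etaK -exprMn.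
rewrite lerXn2r ?nnegrE ?exprn_ge0 ?mulr_ge0 ?ler0n // (le_trans low) //.
by rewrite ler_wpM2r // ler_nat.
Qed.

Let pet_sizes (F : finFieldType) (P : nat -> {poly F}) g f J j0 :
  uniq J -> j0 \in J -> indep P J ->
  (forall j, j \in J -> size (P j) <= size (P j0))%N ->
  [/\ (1 < size (P j0))%N,
    all (fun q : {poly F} => size q <= size (P j0))%N
      (fpolys (prog P g f (rem j0 J)))
  & all (fun q => 1 < size (P j0 - q)%R)%N (fpolys (prog P g f (rem j0 J)))].
Proof.
move=> uJ j0J ind maxJ.
have comb c (a : nat -> F) : (c != 0) || has (fun j => a j != 0) (rem j0 J) ->
    (m < size (c *: P j0 + \sum_(j <- rem j0 J) a j *: P j)%R)%N.
  move=> ca; rewrite -sum_rem_update //; apply: ind.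
  case/orP: ca => [c0|/hasP[j jJ aj]]; first by exists j0; rewrite ?eqxx.
  move: jJ; rewrite mem_rem_uniq // inE => /andP[/negPf jj0 jJ].
  by exists j; rewrite ?jj0.
have szP0 : (m < size (P j0))%N.
  have := comb 1 (fun=> 0) _; rewrite oner_neq0 => /(_ isT).
  by rewrite scale1r big1 ?addr0 // => j _; rewrite scale0r.
have lin j : (j < m)%N -> (size (j%:R *: 'X : {poly F})%R < size (P j0))%N.
  case: j => [|j] jm; first by rewrite scale0r size_poly0 (leq_trans _ szP0).
  apply: leq_ltn_trans szP0; apply: leq_trans jm.
  by rewrite (leq_trans (size_scale_leq _ _)) // size_polyX.
split; first exact: leq_ltn_trans szP0.
- rewrite /fpolys map_cat all_cat -!map_comp !all_map; apply/andP; split.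
    by apply/allP => j; rewrite mem_iota => /andP[_ /lin /ltnW].
  by apply/allP => j /mem_rem; apply: maxJ.
rewrite /fpolys map_cat all_cat -!map_comp !all_map; apply/andP; split.
  apply/allP => j; rewrite mem_iota => /andP[_ /lin jm] /=.
  by rewrite size_polyDl ?size_polyN // (leq_ltn_trans m_gt0).
apply/allP => i iJ /=; apply: leq_ltn_trans m_gt0 _.
have := comb 1 (fun j => if j == i then -1 else 0) _; rewrite oner_neq0 => /(_ isT).
rewrite scale1r (bigD1_seq i) ?rem_uniq //= eqxx scaleN1r big1 ?addr0 //.
by move=> j /negPf->; rewrite scale0r.
Qed.

(** Cauchy-Schwarz in x replaces the distinguished function by the conjugate of
    the dual function. The latter may be centred, since the former has mean zero;
    this is what makes the outcome of degree lowering vanish. *)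
Lemma counting_le_dual (F : finFieldType) (e : F -> C) (P0 Q : {poly F})
    (f0 : F -> C) (l : family C F) :
  bounded f0 -> mean f0 = 0 ->
  `|counting ((P0, f0) :: l) (fun y => e Q.[y])| ^+ 2 <= 2 *
  `|counting ((P0, fun x => (\mean_(z : F * bool)
      centered (dual_kernel e P0 Q l) z x)^*) :: l) (fun y => e Q.[y])|.
Proof.
move=> /boundedP f01 mf0; rewrite !counting_dual.
set G := dual_kernel e P0 Q l; set D := fun x => \mean_(z : F * bool) centered G z x.
pose mu := \mean_(x : F) (\mean_(y : F) G y x).
have DE x : \mean_(y : F) G y x = 2 * D x + mu.
  by rewrite /D mean_centered mulVKf ?pnatr_eq0 // subrK.
have mD : mean D = 0.
  rewrite /D; under eq_mean => x do rewrite mean_centered.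
  rewrite mean_mull meanB [X in _ - X]mean_const ?subrr ?mulr0 //.
  by rewrite (cardD1 0) inE.
have main (h : F -> C) : mean h = 0 ->
    \mean_(x : F) (h x * \mean_(y : F) G y x) = 2 * \mean_(x : F) (h x * D x).
  move=> h0; under eq_mean => x do rewrite DE mulrDr mulrCA.
  by rewrite meanD mean_mull mean_mulr h0 mul0r addr0.
rewrite (main f0 mf0) (main (fun x => (D x)^*)); last by rewrite mean_conj mD rmorph0.
rewrite normrM normr_nat exprMn expr2 -mulrA; rewrite normrM normr_nat mulrA.
rewrite [leRHS]mulrA ler_wpM2l ?mulr_ge0 ?ler0n //.
apply: (le_trans (mean_mul_sqr _ f01)).
rewrite -[leLHS]ger0_norm; last by apply: mean_ge0 => x; rewrite exprn_ge0.
rewrite le_eqVlt; apply/orP; left; apply/eqP; congr (`|_|).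
by apply: eq_mean => x; rewrite normCKC.
Qed.

(** The count is controlled by a Gowers norm of the centred dual function
    ([gowers_control]), and degree lowering brings it down to the absolute value
    of its mean, which is zero. *)
Lemma mean_zero_small ell n K : vanishing ell n K -> exists n' K',
  forall (F : finFieldType) (e : F -> C), addchar e ->
  (forall i, (0 < i <= d)%N -> i%:R != 0 :> F) ->
  forall (P : nat -> {poly F}) (g f : nat -> F -> C) (J : seq nat) (Q : {poly F}) j0,
  size J = ell.+1 -> uniq J -> (forall j, j \in J -> (size (P j) <= d.+1)%N) ->
  (size Q <= d.+1)%N -> j0 \in J ->
  (forall j, j \in J -> size (P j) <= size (P j0))%N -> indep P J ->
  (forall xi, xi != 0 -> nondeg P (rem j0 J) (xi *: P j0 + Q)) ->
  (forall j, bounded (g j)) -> (forall j, bounded (f j)) -> mean (f j0) = 0 ->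
  dom #|F|%:R^-1 n' K' `|counting (prog P g f J) (fun y => e Q.[y])| 0.
Proof.
move=> van; have [s [n1 [K1 pets]]] := gowers_control C d (m + ell).
have [n2 [K2 lower]] := gowers_centered_small s.
eexists; eexists=> F e e_char charF P g f J Q j0 sJ uJ szP szQ j0J maxJ ind ndQ g1 f1 mf0.
have [P1 maxP dP] := pet_sizes g f uJ j0J ind maxJ.
have sJ' : size (rem j0 J) = ell by rewrite size_rem // sJ.
set l := prog P g f (rem j0 J).
set D := fun x => \mean_(z : F * bool) centered (dual_kernel e (P j0) Q l) z x.
have e1 : bounded (fun y => e Q.[y]).
  by apply/boundedP => y; rewrite (norm_addchar e_char).
have l1 : fbounded l by apply: fbounded_prog.
have D1 : bounded D.
  apply/boundedP => x; apply: norm_mean_le1 => z; rewrite /centered.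
  have G1 y w : `|dual_kernel e (P j0) Q l y w| <= 1.
    rewrite normrM (norm_addchar e_char) mul1r; apply: norm_fprod.
    by rewrite /fbounded all_map.
  by case: z.2 => //; rewrite normrN; do 2!apply: norm_mean_le1 => ?.
have eps0 := inv_card_ge0 C F; have eps1 := inv_card_le1 C F.
pose a1 := `|counting ((P j0, fun x => (D x)^*) :: l) (fun y => e Q.[y])|.
have dom1 : dom #|F|%:R^-1 1 2 `|counting (prog P g f J) (fun y => e Q.[y])| a1.
  rewrite (counting_rem _ _ _ _ j0J) /dom expn1.
  apply: (le_trans (counting_le_dual _ _ _ _ (f1 j0) mf0)).
  by rewrite ler_wpM2l ?ler0n // lerDl.
have dom2 : dom #|F|%:R^-1 n1 K1 a1 (gowers s D).
  rewrite -gowers_conj; apply: pets => //.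
  - by rewrite size_cat !size_map size_iota sJ'.
  - by rewrite P1 szP.
  - exact: bounded_conj.
have dom3 : dom #|F|%:R^-1 (n2 + n) (K2.+1 ^ (2 ^ n) * K) (gowers s D) 0.
  apply: (lower _ _ _ van F e) => //.
  - exact: rem_uniq.
  - by move=> j /mem_rem; apply: szP.
  - exact: szP.
  - by move=> xi xi0; apply: indep_rem.
have dom12 := dom_trans eps0 eps1 (normr_ge0 _) (normr_ge0 _) (gowers_ge0 s D) dom1 dom2.
exact: (dom_trans eps0 eps1 (normr_ge0 _) (gowers_ge0 s D) (lexx 0) dom12 dom3).
Qed.

(** The factor 1/2 keeps the function bounded by 1. *)
Definition recenter (F : finFieldType) (f : nat -> F -> C) j0 j : F -> C :=
  if j == j0 then fun x => 2^-1 * (f j0 x - mean (f j0)) else f j.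

Let bounded_recenter (F : finFieldType) (f : nat -> F -> C) j0 :
  (forall j, bounded (f j)) -> forall j, bounded (recenter f j0 j).
Proof.
move=> f1 j; rewrite /recenter; case: eqP => // _.
apply/boundedP => x; rewrite normrM normfV normr_nat ler_pdivrMl ?ltr0n // mulr1.
have f1' y : `|f j0 y| <= 1 := boundedP _ (f1 j0) y.
by rewrite (le_trans (ler_normB _ _)) // [leRHS](natrD _ 1 1) lerD // norm_mean_le1.
Qed.

Let mean_recenter (F : finFieldType) (f : nat -> F -> C) j0 :
  mean (recenter f j0 j0) = 0.
Proof.
rewrite /recenter eqxx mean_mull meanB mean_const ?subrr ?mulr0 //.
by rewrite (cardD1 0) inE.
Qed.

Lemma counting_recenter (F : finFieldType) (P : nat -> {poly F}) g f J b j0 :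
  uniq J -> j0 \in J -> counting (prog P g f J) b =
  mean (f j0) * counting (prog P g f (rem j0 J)) b +
  2 * counting (prog P g (recenter f j0) J) b.
Proof.
move=> uJ j0J; rewrite !(counting_rem _ _ _ _ j0J).
have -> : prog P g (recenter f j0) (rem j0 J) = prog P g f (rem j0 J).
  congr (_ ++ _); apply/eq_in_map => j; rewrite mem_rem_uniq // inE.
  by rewrite /recenter => /andP[/negPf->].
rewrite -!mean_mull -meanD; apply: eq_mean => x.
rewrite -!mean_mull -meanD; apply: eq_mean => y.
rewrite /recenter eqxx /fprod !big_cons /= -!mulrA mulVKf ?pnatr_eq0 //.
by rewrite -mulrDl [mean _ + _]addrC subrK.
Qed.

(** Without polynomial terms this is [weyl]: there are m linear terms and the
    degree of the phase is at least m. Otherwise a function is split into its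
    mean, which leaves one term less, and a multiple of a function of mean
    zero. *)
Lemma vanishing_all ell : exists n K, vanishing ell n K.
Proof.
elim: ell => [|ell [n [K van]]].
  have [n [K exp_sum]] := weyl C d.-1; exists n, K.
  move=> F e e_char charF P g f J Q /size0nil-> _ _ szQ nd g1 f1.
  have mQ : (m < size Q)%N.
    have := nd 1 (fun=> 0); rewrite big_nil scale1r addr0 oner_neq0; apply.
    by left.
  have d0 : (0 < d)%N by rewrite -ltnS (leq_trans _ szQ) // (leq_ltn_trans m_gt0).
  apply: exp_sum => //.
  - by rewrite prednK.
  - rewrite /prog cats0 all_map; apply/allP => j _; rewrite /linear_term /=.
    by rewrite (leq_trans (size_scale_leq _ _)) // size_polyX.
  - exact: fbounded_prog.
  - by rewrite /prog cats0 size_map size_iota.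
  - by rewrite prednK // szQ (leq_ltn_trans m_gt0).
have [n' [K' core]] := mean_zero_small van.
eexists; eexists=> F e e_char charF P g f J Q sJ uJ szP szQ nd g1 f1.
have [j0 j0J maxJ] : exists2 j0, j0 \in J & forall j, j \in J ->
    (size (P j) <= size (P j0))%N by apply: max_degree; rewrite -size_eq0 sJ.
have sJ' : size (rem j0 J) = ell by rewrite size_rem // sJ.
have e1 : bounded (fun y => e Q.[y]).
  by apply/boundedP => y; rewrite (norm_addchar e_char).
have ind := nondeg_indep nd.
have f'1 := bounded_recenter j0 f1.
have small1 := core F e e_char charF P g (recenter f j0) J Q j0 sJ uJ szP szQ j0J
  maxJ ind (fun xi _ => nondeg_rem xi uJ j0J nd) g1 f'1 (mean_recenter f j0).
have ndJ' : nondeg P (rem j0 J) Q.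
  by have := nondeg_rem 0 uJ j0J nd; rewrite scale0r add0r.
have small2 := van F e e_char charF P g f (rem j0 J) Q sJ' (rem_uniq _ uJ)
  (fun j jJ => szP j (mem_rem jJ)) szQ ndJ' g1 f1.
apply: (dom_add _ _ _ _ _ _ _ small2 small1) => //.
- exact: inv_card_ge0.
- by apply: norm_counting => //; apply: fbounded_prog.
- by apply: norm_counting => //; apply: fbounded_prog.
rewrite (counting_recenter _ _ _ _ uJ j0J) (le_trans (ler_normD _ _)) //.
rewrite [X in _ + X <= _]normrM normr_nat lerD2r normrM ler_wpM2r //.
rewrite (@le_trans _ _ 1) ?ler1n //.
by apply: norm_mean_le1 => x; apply: (boundedP _ (f1 j0)).
Qed.

(** The functions are replaced by their means one at a time, always one whose
    polynomial has maximal degree, as [mean_zero_small] requires. *)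
Lemma discorrelation ell : exists n K,
  forall (F : finFieldType) (e : F -> C), addchar e ->
  (forall i, (0 < i <= d)%N -> i%:R != 0 :> F) ->
  forall (P : nat -> {poly F}) (g f : nat -> F -> C) (J : seq nat),
  size J = ell -> uniq J -> (forall j, j \in J -> (size (P j) <= d.+1)%N) ->
  indep P J -> (forall j, bounded (g j)) -> (forall j, bounded (f j)) ->
  dom #|F|%:R^-1 n K (2^-1 * `|counting (prog P g f J) (fun=> 1) -
    counting (prog P g f [::]) (fun=> 1) * \prod_(j <- J) mean (f j)|) 0.
Proof.
elim: ell => [|ell [n [K IH]]].
  exists 0%N, 0%N => F e e_char charF P g f J /size0nil-> _ _ _ _ _.
  by rewrite big_nil mulr1 subrr normr0 mulr0 /dom expr0n mul0r.
have [n0 [K0 van]] := vanishing_all ell.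
have [n' [K' core]] := mean_zero_small van.
eexists; eexists=> F e e_char charF P g f J sJ uJ szP ind g1 f1.
have [j0 j0J maxJ] : exists2 j0, j0 \in J & forall j, j \in J ->
    (size (P j) <= size (P j0))%N by apply: max_degree; rewrite -size_eq0 sJ.
have sJ' : size (rem j0 J) = ell by rewrite size_rem // sJ.
have b1 : bounded (fun _ : F => 1 : C) by apply/boundedP => y; rewrite normr1.
have f'1 := bounded_recenter j0 f1.
have ind' : indep P (rem j0 J).
  exact: (nondeg_indep (indep_rem uJ j0J (oner_neq0 F) ind)).
have small1 : dom #|F|%:R^-1 n' K'
    `|counting (prog P g (recenter f j0) J) (fun=> 1)| 0.
  (* The weight 1 is the phase of the zero polynomial. *)
  have -> : counting (prog P g (recenter f j0) J) (fun=> 1) =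
     counting (prog P g (recenter f j0) J) (fun y => e (0 : {poly F}).[y]).
    apply: eq_mean => x; apply: eq_mean => y.
    by rewrite horner0 (addchar0 e_char).
  apply: (core F e e_char charF P g _ J 0 j0 sJ uJ szP _ j0J) => //.
  - by rewrite size_poly0.
  - by move=> xi xi0; rewrite addr0; apply: indep_rem.
have mean1 j : `|mean (f j)| <= 1.
  by apply: norm_mean_le1 => x; apply: (boundedP _ (f1 j)).
have small2 := IH F e e_char charF P g f (rem j0 J) sJ' (rem_uniq _ uJ)
  (fun j jJ => szP j (mem_rem jJ)) ind' g1 f1.
have half0 : 0 <= 2^-1 :> C by rewrite invr_ge0 ler0n.
apply: (dom_add _ _ _ _ _ _ _ small2 small1) => //.
- exact: inv_card_ge0.
- exact: mulr_ge0.
- rewrite ler_pdivrMl ?ltr0n // mulr1 (le_trans (ler_normB _ _)) // [leRHS](natrD _ 1 1).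
  rewrite lerD ?norm_counting ?fbounded_prog //.
  rewrite normrM mulr_ile1 ?norm_counting ?fbounded_prog // normr_prod.
  by apply: prodr_ile1 => j; rewrite normr_ge0 mean1.
- by apply: norm_counting => //; apply: fbounded_prog.
- exact: mulr_ge0.
rewrite (counting_recenter _ _ _ _ uJ j0J) (perm_big _ (perm_to_rem j0J)) big_cons.
set X := counting _ _; set Z := counting _ _; set Y := counting _ _.
set M := \prod_(j <- _) _; set mu := mean _.
have -> : mu * X + 2 * Z - Y * (mu * M) = mu * (X - Y * M) + 2 * Z.
  by rewrite mulrBr addrAC [Y * _]mulrCA.
apply: (@le_trans _ _ (2^-1 * (`|X - Y * M| + 2 * `|Z|))).
  rewrite ler_wpM2l // (le_trans (ler_normD _ _)) // !normrM normr_nat lerD2r.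
  by rewrite ler_piMl // /mu.
rewrite mulrDr mulKf ?pnatr_eq0 // lerD //.
  by rewrite mulVKf ?pnatr_eq0 // ler_piMl // invf_le1 ?ltr0n // ler1n.
by rewrite ler_peMl // ler1n.
Qed.

End MeanZero.
End Progression.

(** * Reduction modulo a prime *)

Section PrimeField.

Lemma addchar_Fp (C : numClosedFieldType) p : prime p ->
  exists e : 'F_p -> C, addchar e.
Proof.
move=> p_pr; pose Phi : {poly C} := \poly_(i < p) 1.
have szPhi : size Phi = p by rewrite size_poly_eq ?oner_neq0.
have /closed_rootP[z] : size Phi != 1.
  by rewrite szPhi; apply: contraTneq p_pr => ->.
rewrite rootE horner_poly => /eqP Phiz.
have sumz : \sum_(i < p) z ^+ i = 0.
  by rewrite -[RHS]Phiz; apply: eq_bigr => i _; rewrite mul1r.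
have zp : z ^+ p = 1 by apply/eqP; rewrite -subr_eq0 subrX1 sumz mulr0.
have z1 : z != 1.
  apply: contra_eq_neq sumz => ->.
  under eq_bigr => i _ do rewrite expr1n.
  by rewrite sumr_const card_ord pnatr_eq0 -lt0n prime_gt0.
have nz : `|z| = 1.
  by apply/eqP; rewrite -(@pexpr_eq1 _ _ p) ?prime_gt0 // -normrX zp normr1.
exists (fun x : 'F_p => z ^+ x); split=> [x y|x|]; last 2 first.
- by rewrite normrX nz expr1n.
- by exists 1; rewrite /= modn_small ?expr1 // Fp_cast // prime_gt1.
have -> : nat_of_ord (x + y) = ((x + y) %% p)%N.
  by rewrite /=; congr (_ %% _)%N; apply: Fp_cast.
by rewrite expr_mod // exprD.
Qed.

Lemma natr_Fp_neq0 p d i : prime p -> (d < p)%N -> (0 < i <= d)%N ->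
  i%:R != 0 :> 'F_p.
Proof.
move=> p_pr dp /andP[i0 id]; rewrite -(dvdn_pcharf (pchar_Fp p_pr)).
by rewrite gtnNdvd // (leq_ltn_trans id).
Qed.

Lemma intr_Fp_neq0 p (z : int) : prime p -> z != 0 -> (`|z| < p)%N ->
  z%:~R != 0 :> 'F_p.
Proof.
move=> p_pr z0 zp; have := @natr_Fp_neq0 p `|z| `|z| p_pr zp.
rewrite absz_gt0 z0 leqnn => /(_ isT).
by case: z {z0 zp} => n //=; rewrite NegzE intrN oppr_eq0.
Qed.

(** The coefficients in degrees at least m form a matrix of full rank over the
    reals, hence with a nonzero integer minor; this minor stays nonzero modulo
    all larger primes. *)
Lemma indep_mod_p (R : realType) m k (P : nat -> {poly int}) :
  lincomb_deg_ge R m k P -> exists p0, forall p, prime p -> (p0 <= p)%N ->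
  indep m (fun j => map_poly intr (P j) : {poly 'F_p}) (index_iota m (m + k)).
Proof.
move=> indR; pose D := (\sum_(m <= j < m + k) size (P j))%N.
have szD j : (m <= j < m + k)%N -> (size (P j) <= D)%N.
  by move=> mj; rewrite /D (bigD1_seq j) ?mem_index_iota ?iota_uniq //= leq_addr.
pose A := \matrix_(i < k, j < D) (P (m + i)%N)`_(m + j).
have combE (K : fieldType) (a : nat -> K) (v : 'rV[K]_k) :
    (forall i : 'I_k, a (m + i)%N = v 0 i) -> v *m map_mx intr A = 0 ->
    (size (\sum_(m <= j < m + k) a j *: map_poly intr (P j))%R <= m)%N.
  move=> av vA; apply/leq_sizeP => j mj.
  rewrite -{1}[m]add0n big_addn addKn big_mkord coef_sum.
  have [jD|Dj] := ltnP (j - m) D.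
    have /matrixP/(_ 0 (Ordinal jD)) := vA; rewrite !mxE => vAj.
    rewrite -[RHS]vAj; apply: eq_bigr => i _; rewrite !mxE /= coefZ coef_map_id0 ?intr0 //.
    by rewrite addnC av subnKC.
  apply: big1 => i _; rewrite coefZ coef_map_id0 ?intr0 // nth_default ?intr0 ?mulr0 //.
  rewrite (leq_trans (szD _ _)) ?(leq_trans Dj) ?leq_subr //.
  by rewrite leq_addl addnC ltn_add2l /=.
have freeR : row_free (map_mx intr A : 'M[R]_(k, D)).
  rewrite -kermx_eq0; apply/eqP/row_matrixP => i; rewrite row0.
  set v := row i _; apply/eqP/negPn/negP => v0.
  have vA : v *m map_mx intr A = 0 by rewrite -row_mul mulmx_ker row0.
  pose a j := if insub (j - m)%N is Some i' then v 0 i' else 0.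
  have av (i' : 'I_k) : a (m + i')%N = v 0 i'.
    by rewrite /a addKn valK.
  have := combE _ a v av vA; rewrite leqNgt => /negP; apply; apply: indR.
  have /rV0Pn[i' vi'] := v0.
  by exists (m + i')%N; rewrite ?leq_addr ?ltn_add2l ?ltn_ord ?av.
have fullR : row_full (map_mx intr A : 'M[R]_(k, D))^T.
  by rewrite /row_full mxrank_tr.
have [h hu] : exists h : 'I_k -> 'I_D,
    rowsub h (map_mx intr A : 'M[R]_(k, D))^T \in unitmx.
  by exists (fullrankfun fullR); apply: fullrowsub_unit.
pose B := rowsub h A^T.
have B0 : \det B != 0.
  move: hu; rewrite unitmxE unitfE map_trmx -map_mxsub.
  by rewrite det_map_mx intr_eq0.
exists (`|\det B|.+1)%N => p p_pr pB a [j0]; rewrite mem_index_iota => /andP[mj jmk] aj.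
rewrite ltnNge; apply/negP => small.
pose v : 'rV['F_p]_k := \row_i a (m + i)%N.
have vA : v *m map_mx intr A = 0.
  apply/rowP => j; rewrite !mxE.
  move/leq_sizeP: small => /(_ (m + j)%N (leq_addr _ _)) smallj; rewrite -[RHS]smallj.
  rewrite -[X in index_iota X _]add0n big_addn addKn big_mkord coef_sum.
  apply: eq_bigr => i _; rewrite !mxE coefZ coef_map_id0 ?intr0 //.
  by rewrite [(i + m)%N]addnC.
have Bu : (map_mx intr B : 'M['F_p]_k) \in unitmx.
  by rewrite unitmxE unitfE det_map_mx intr_Fp_neq0.
have Bv : map_mx intr B *m v^T = 0.
  apply/colP => i; rewrite !mxE; have /rowP/(_ (h i)) := vA.
  rewrite !mxE => vAi; rewrite -[RHS]vAi; apply: eq_bigr => j _.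
  by rewrite !mxE mulrC.
have v0 : v = 0.
  by apply: trmx_inj; rewrite trmx0 -[LHS](mulKmx Bu) Bv mulmx0.
have j0k : (j0 - m < k)%N by rewrite ltn_subLR.
move/rowP/(_ (Ordinal j0k)): v0; rewrite !mxE /= subnKC // => aj0.
by rewrite aj0 eqxx in aj.
Qed.

End PrimeField.

Local Open Scope complex_scope.

(** The exponent of p is the inverse of the power of 2 in [dom]. *)
Lemma dom_powR (R : realType) (x : R[i]) n K p : (0 < p)%N -> 0 <= x ->
  dom p%:R^-1 n K (2^-1 * x) 0 ->
  x <= ((2 * K.+1%:R) * (p%:R `^ (- ((2 ^ n)%:R^-1))))%:C.
Proof.
move=> p0 x0; rewrite /dom add0r exprMn exprVn ler_pdivrMl ?exprn_gt0 ?ltr0n //.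
move=> xK; have N0 : (0 < 2 ^ n)%N by rewrite expn_gt0.
set y : R := _ * _; have y0 : 0 <= y by rewrite !mulr_ge0 ?ler0n ?powR_ge0.
have yE : y ^+ (2 ^ n) = (2 * K.+1%:R) ^+ (2 ^ n) * p%:R^-1.
  rewrite exprMn -[X in _ * X = _]powR_mulrn ?powR_ge0 // -powRrM mulNr mulVf ?pnatr_eq0 -?lt0n //.
  by rewrite powR_inv1 ?ler0n.
rewrite -(@ler_pXn2r _ (2 ^ n)) ?nnegrE ?lecR //.
apply: (le_trans xK).
have -> : y%:C ^+ (2 ^ n) = (y ^+ (2 ^ n))%:C by rewrite rmorphXn.
rewrite yE.
have -> : 2 ^+ (2 ^ n) * (K%:R * p%:R^-1) =
    (2 ^+ (2 ^ n) * (K%:R * p%:R^-1) : R)%:C.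
  by rewrite !rmorphM rmorphXn /= !rmorph_nat fmorphV rmorph_nat.
rewrite lecR exprMn -mulrA ler_wpM2l ?exprn_ge0 ?ler0n //.
rewrite ler_wpM2r ?invr_ge0 ?ler0n // -natrX ler_nat.
by rewrite (leq_trans (leqnSn K)) // -{1}[K.+1]expn1 leq_pexp2l.
Qed.

Theorem theorem3 (R : realType) (m k : nat) (P : nat -> {poly int})
    (hm : (1 <= m)%N) (hk : (1 <= k)%N) (hP : lincomb_deg_ge R m k P) :
  exists (c C : R) (p0 : nat), 0 < c /\ 0 < C /\
    forall p : nat, prime p -> (p0 <= p)%N ->
    forall f : nat -> 'F_p -> R[i],
      (forall (j : nat) (x : 'F_p), (j < m + k)%N -> `|f j x| <= 1) ->
      `| avg (fun xy : 'F_p * 'F_p =>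
            \prod_(0 <= j < m) f j (xy.1 + j%:R * xy.2) *
            \prod_(m <= j < m + k) f j (xy.1 + zeval (P j) xy.2))
         - avg (fun xy : 'F_p * 'F_p =>
              \prod_(0 <= j < m) f j (xy.1 + j%:R * xy.2)) *
           \prod_(m <= j < m + k) avg (f j) |
      <= (C * (p%:R `^ (- c)))%:C.
Proof.
have [p0 indP] := indep_mod_p hP.
pose d := (\sum_(m <= j < m + k) size (P j))%N.
have [n [K bound]] := @discorrelation R[i] m d hm k.
exists ((2 ^ n)%:R^-1), (2 * K.+1%:R), (maxn p0 d.+1); split.
  by rewrite invr_gt0 ltr0n expn_gt0.
split; first by rewrite mulr_gt0 ?ltr0n.
move=> p p_pr; rewrite geq_max => /andP[pp0 dp] f f1.
have [e e_char] := addchar_Fp R[i] p_pr.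
pose Pp j : {poly 'F_p} := map_poly intr (P j).
(* Only the functions of the progression are assumed to be bounded. *)
pose f' j : 'F_p -> R[i] := if (j < m + k)%N then f j else fun=> 0.
have f'1 j : bounded (f' j).
  by apply/boundedP => x; rewrite /f'; case: ifP => [/f1//|_]; rewrite normr0.
have f'E j : (j < m + k)%N -> f' j = f j by rewrite /f' => ->.
have avgE (T : finType) (F : T -> R[i]) : avg F = mean F by rewrite meanE.
have szP j : j \in index_iota m (m + k) -> (size (Pp j) <= d.+1)%N.
  move=> jmk; rewrite (leq_trans (size_poly _ _)) // ltnW // ltnS.
  by rewrite /d (bigD1_seq j) ?iota_uniq //= leq_addr.
have := bound 'F_p e e_char (fun i => natr_Fp_neq0 p_pr dp) Pp f' f'
  (index_iota m (m + k)) _ (iota_uniq _ _) szP (indP p p_pr pp0) f'1 f'1.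
rewrite size_iota addKn card_Fp // => /(_ erefl)/(dom_powR (prime_gt0 p_pr)).
move=> /(_ (normr_ge0 _)); congr (`|_| <= _).
rewrite !avgE !mean_pair; congr (_ - _ * _).
- apply: eq_mean => x; apply: eq_mean => y; rewrite mulr1 fprod_prog.
  by congr (_ * _); rewrite !big_nat; apply: eq_bigr => j /andP[_ jm];
    rewrite f'E // (leq_trans jm) // leq_addr.
- apply: eq_mean => x; apply: eq_mean => y; rewrite mulr1 fprod_prog big_nil mulr1.
  by rewrite !big_nat; apply: eq_bigr => j jm; rewrite f'E // (leq_trans jm) // leq_addr.
- by rewrite !big_nat; apply: eq_bigr => j /andP[_ jm]; rewrite avgE f'E.
Qed.
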